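(* $V^7-M^4$ is a tubular neighborhood of $M^5$ (inside $V^7$), whose cross sections are round cells of angular radius $\pi/4$ on great $2$-spheres of $S^8(\sqrt3)$ which meet $M^5$ orthogonally.
   Context: Real $3\times3$ matrices are identified with points of Euclidean space $\mathbb{R}^9$ with norm $\|A\|^2=\sum_{i,j}a_{ij}^2$, and $S^8(\sqrt3)$ is the round sphere of matrices of norm $\sqrt3$. $V^7$ is the set of singular matrices on $S^8(\sqrt3)$, and $M^4\subset V^7$ is the subset of matrices of rank $1$; $V^7-M^4$, the set of rank $2$ matrices on $S^8(\sqrt3)$, is a smooth $7$-dimensional submanifold of $S^8(\sqrt3)$. A ''best'' $3\times3$ matrix of rank $2$ is one which is orthogonal (i.e. restricts to a linear isometry onto its image) on a $2$-plane through the origin in $\mathbb{R}^3$ and zero on the orthogonal complement of that plane. $M^5\subset V^7-M^4$ is the set of best $3\times 3$ matrices of rank $2$, scaled up to lie on $S^8(\sqrt3)$ (i.e. multiplied by $\sqrt{3/2}$); it is a smooth $5$-dimensional submanifold. The cross section at $P\in M^5$ is the open disk of points $(\cos t)P+(\sin t)T$, $0\le t<\pi/4$, where $T$ ranges over vectors of norm $\sqrt3$ in the $2$-dimensional orthogonal complement $(T_PM^5)^\perp$ of $T_PM^5$ in $T_PV^7$; being a tubular neighborhood with these cross sections means that these disks fibre $V^7-M^4$ over $M^5$ (they are pairwise disjoint with union $V^7-M^4$, the normal exponential map identifying the open disk bundle of angular radius $\pi/4$ with $V^7-M^4$). *)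

(* Defs.v *)
From HB Require Import structures.
From mathcomp Require Import all_boot all_order all_algebra.
From mathcomp Require Import all_classical all_reals all_analysis.

Set Implicit Arguments.
Unset Strict Implicit.
Unset Printing Implicit Defensive.

Import Order.TTheory GRing.Theory Num.Theory.
Import numFieldNormedType.Exports.

Local Open Scope classical_set_scope.
Local Open Scope ring_scope.

Section Euclidean.
Context {R : realType} {m n : nat}.
Implicit Types A B : 'M[R]_(m, n).

Definition edot A B : R := \sum_i \sum_j A i j * B i j.

(* The norm that the library puts on matrices is the sup norm: it is only used
   here through the topology, which is the same. *)
Definition enorm A : R := Num.sqrt (\sum_i \sum_j A i j ^+ 2).

Definition angle A B : R := acos (edot A B / (enorm A * enorm B)).

End Euclidean.

(* In finite dimension, all [fun x => 'd f x v] being C^k means that the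
   Frechet derivative of [f] is C^k. *)
Fixpoint Ck_on {R : realType} {V W : normedModType R} (k : nat) (U : set V)
    (f : V -> W) : Prop :=
  match k with
  | 0 => forall x, U x -> {for x, continuous f}
  | k'.+1 => (forall x, U x -> differentiable f x) /\
             (forall v, Ck_on k' U (fun x => 'd f x v))
  end.

Definition smooth_on {R : realType} {V W : normedModType R} (U : set V)
    (f : V -> W) : Prop := forall k, Ck_on k U f.

(* Smoothness on an arbitrary subset [X]: local extendability to a smooth map
   on an open set of the ambient space. *)
Definition smooth_map {R : realType} {V W : normedModType R} (X : set V)
    (f : V -> W) : Prop :=
  forall x, X x -> exists (U : set V) (F : V -> W),
    [/\ open U, U x, smooth_on U F & forall y, X y -> U y -> f y = F y].

Definition diffeomorphism {R : realType} {V W : normedModType R}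
    (X : set V) (Y : set W) (f : V -> W) : Prop :=
  [/\ set_bij X Y f, smooth_map X f &
      exists2 g : W -> V, (forall x, X x -> g (f x) = x) & smooth_map Y g].

Section Geometry.
Context {R : realType}.
Implicit Types (V M X Sigma : set 'M[R]_3) (P Q N T A B : 'M[R]_3) (r : R).

(* Velocities at [P] of the smooth curves in [X] through [P]. *)
Definition tangent_space X P : set 'M[R]_3 :=
  [set v : 'M[R]_3 | exists (I : set R^o) (gamma : R^o -> 'M[R]_3),
     [/\ open I, I 0 & smooth_on I gamma] /\
     [/\ forall t, I t -> X (gamma t), gamma 0 = P & 'D_1 gamma 0 = v]].

Definition S8 : set 'M[R]_3 := [set A : 'M[R]_3 | enorm A = Num.sqrt 3].

Definition V7 : set 'M[R]_3 := [set A : 'M[R]_3 | S8 A /\ \det A = 0].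

Definition M4 : set 'M[R]_3 := [set A : 'M[R]_3 | V7 A /\ \rank A = 1%N].

Definition best_rank2 A : Prop :=
  exists U : {vspace 'cV[R]_3},
    [/\ \dim U = 2%N,
        forall u, u \in U -> enorm (A *m u) = enorm u &
        forall w, (forall u, u \in U -> edot u w = 0) -> A *m w = 0].

Definition M5 : set 'M[R]_3 :=
  [set A : 'M[R]_3 | exists2 B, best_rank2 B & A = Num.sqrt (3 / 2) *: B].

(* Orthogonal complement of T_P M in T_P V. *)
Definition normal_vectors V M P : set 'M[R]_3 :=
  [set N : 'M[R]_3 | tangent_space V P N /\
           forall v, tangent_space M P v -> edot N v = 0].

Definition cross_section V M r P : set 'M[R]_3 :=
  [set A : 'M[R]_3 | exists t T,
     [/\ 0 <= t < r, normal_vectors V M P T, enorm T = Num.sqrt 3 &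
         A = cos t *: P + sin t *: T]].

(* On the sphere of radius [Num.sqrt 3], the angular length of [N] is
   [enorm N / Num.sqrt 3]. *)
Definition angular_length N : R := enorm N / Num.sqrt 3.

Definition disk_bundle V M r : set ('M[R]_3 * 'M[R]_3) :=
  [set PN : 'M[R]_3 * 'M[R]_3 | [/\ M PN.1, normal_vectors V M PN.1 PN.2 &
                angular_length PN.2 < r]].

(* Exponential map of the sphere at [PN.1], applied to [PN.2] = t *: T with
   [enorm T = Num.sqrt 3]; for [PN.2 = 0] the value is [PN.1]. *)
Definition sphere_exp (PN : 'M[R]_3 * 'M[R]_3) : 'M[R]_3 :=
  let t := angular_length PN.2 in
  cos t *: PN.1 + (sin t / t) *: PN.2.

Definition great_2sphere Sigma : Prop :=
  exists2 W : {vspace 'M[R]_3}, \dim W = 3%N & Sigma = S8 `&` [set` W].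

(* Open round cell on [Sigma] with centre [P] and angular radius [r]. *)
Definition round_cell Sigma r P : set 'M[R]_3 :=
  [set A : 'M[R]_3 | Sigma A /\ angle P A < r].

Definition meet_orthogonally_at Sigma M P : Prop :=
  [/\ Sigma P, M P &
      forall u v, tangent_space Sigma P u -> tangent_space M P v ->
        edot u v = 0].

(* [N] is a tubular neighborhood of [M] inside [V], with fibres the normal
   disks of angular radius [r]. *)
Definition tubular_neighborhood V M r (N : set 'M[R]_3) : Prop :=
  [/\ M `<=` N,
      exists2 U : set 'M[R]_3, open U & N = V `&` U,
      forall P Q, M P -> M Q ->
        cross_section V M r P `&` cross_section V M r Q !=set0 -> P = Q,
      \bigcup_(P in M) cross_section V M r P = N &
      diffeomorphism (disk_bundle V M r) N sphere_exp /\
      forall P, M P ->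
        sphere_exp @` (disk_bundle V M r `&` [set PN : 'M[R]_3 * 'M[R]_3 | PN.1 = P]) =
        cross_section V M r P].

End Geometry.

(* Main.v *)
Require Import Defs.
From HB Require Import structures.
From mathcomp Require Import all_boot all_order all_algebra.
From mathcomp Require Import all_classical all_reals all_analysis.
From mathcomp Require Import ring lra.
Set Implicit Arguments.
Unset Strict Implicit.
Unset Printing Implicit Defensive.
Import Order.TTheory GRing.Theory Num.Theory.
Import numFieldNormedType.Exports.
Local Open Scope classical_set_scope.
Local Open Scope ring_scope.

(** Multiplying on the left and on the right by orthogonal matrices preserves
    the inner product, V^7, M^4 and M^5, hence also normal vectors, and every
    question reduces to the plane of the first two coordinates. A matrix of that
    plane is the sum of a multiple of a rotation and of a multiple of a
    reflection; up to one more rotation it is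
<<
      p + a   b
      b       p - a
>>
    called [planar p a b]. Its singular values are |p + r| and |p - r| with
    r^2 = a^2 + b^2.

    Points of M^5 are exactly the U (planar best_scale 0 0) V^T with U and V
    orthogonal ([M5_frame]). At such a point the tangent space of M^5 is obtained
    by multiplying by skew-symmetric matrices on either side. Together with the
    equations for V^7 (norm and determinant) this leaves as normal vectors the
    U (planar 0 a b) V^T ([normal_planar], [normal_frame]). The sphere
    exponential of a normal vector of angular length t is then
    U (planar (cos t * best_scale) a b) V^T with 2 (a^2 + b^2) = 3 sin(t)^2, and
    its planar determinant p^2 - a^2 - b^2 is (3/2) cos(2 t): it is positive, that
    is, the rank stays 2, exactly until t reaches pi/4.

    Conversely the two kernels and the polar decomposition put every matrix of
    rank 2 of V^7 in this form with p > 0 and p^2 > a^2 + b^2 ([planar_form]). The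
    form is recovered from A without choosing U and V: the planar cofactor matrix
    U (planar p (-a) (-b)) V^T equals (|A|^2 A - A A^T A) / d, where d > 0 is the
    planar determinant, a square root of a polynomial in A; the sum and the
    difference of A and of its planar cofactor are the directions of the foot
    point and of the normal vector ([footpoint], [normal_part]). This gives a
    smooth inverse of the exponential ([retraction_bundle],
    [smooth_retraction]).

    Along the zero section smoothness is not visible on the formulas, which
    involve sin(t) / t and t / sin(t) while t is only the square root of a smooth
    function. The functions cos(t) and sin(t) / t are entire functions of t^2
    ([cosq], [sincq]), and t / sin(t) is a smooth function of sin(t)^2, because
    y |-> sin(sqrt y)^2 extends to negative y near 0 with positive derivative
    ([smooth_angle_ratio]). *)

(** * Calculus of the classes C^k *)

Section CkCalculus.
Context {R : realType}.

Lemma near_eq_diff (V W : normedModType R) (f g : V -> W) (x : V) :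
  (\forall y \near x, f y = g y) -> differentiable f x ->
  differentiable g x /\ 'd g x = 'd f x :> (V -> W).
Proof.
move=> fg df; have [cf ef] := (diff_locallyP x f).1 df.
have eg : g \o shift x = cst (g x) + 'd f x +o_ 0 id.
  have /eqaddoP Hf := ef.
  apply/eqaddoP => e e0; have := Hf _ e0.
  have fgs : \forall y \near 0, (f \o shift x) y = (g \o shift x) y.
    rewrite (near_shift x) /=; near=> y => /=; rewrite sub0r subrK.
    by near: y.
  apply: filterS2 fgs => y /= fgy.
  by rewrite !fctE /= fgy (nbhs_singleton fg).
have dg : 'd g x = 'd f x :> (V -> W) by apply: diff_unique.
have ddg : differentiable g x.
  by apply/diff_locallyP; rewrite dg; split; [exact: cf|exact: eg].
exact: (conj ddg dg).
Unshelve. all: by end_near. Qed.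

(** Higher derivatives only see germs, so equality on an open set suffices; the
    rules below compute a differential on [U] only, and conclude by this
    lemma. *)
Lemma eq_Ck_on (V W : normedModType R) k (U : set V) (f g : V -> W) :
  open U -> (forall x, U x -> f x = g x) -> Ck_on k U f -> Ck_on k U g.
Proof.
move=> oU; elim: k f g => [|k IH] f g fg.
  move=> cf x Ux; have nfg : \forall y \near x, f y = g y.
    by apply: filterS (open_nbhs_nbhs (conj oU Ux)) => y /fg.
  have := cf x Ux; rewrite /prop_for /continuous_at (fg _ Ux) => cfx.
  apply: cvg_trans cfx.
  exact: near_eq_cvg.
move=> [df dfk]; have nfg x : U x -> differentiable g x /\ 'd g x = 'd f x :> (V -> W).
  move=> Ux; apply: near_eq_diff (df _ Ux).
  by apply: filterS (open_nbhs_nbhs (conj oU Ux)) => y /fg.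
split=> [x /nfg[]//|v]; apply: IH (dfk v) => x Ux.
exact: (esym (congr1 (@^~ v) (nfg _ Ux).2)).
Qed.

Lemma Ck_on_subset (V W : normedModType R) k (A B : set V) (f : V -> W) :
  A `<=` B -> Ck_on k B f -> Ck_on k A f.
Proof.
move=> AB; elim: k f => [|k IH] f /=; first by move=> cf x /AB /cf.
by move=> [df dfk]; split=> [x /AB /df|v]//; apply: IH.
Qed.

Lemma Ck_onW (V W : normedModType R) k (U : set V) (f : V -> W) :
  Ck_on k.+1 U f -> Ck_on k U f.
Proof.
elim: k f => [|k IH] f /= [df dfk].
  by move=> x /df /differentiable_continuous.
by split=> // v; apply: IH.
Qed.

Lemma Ck_on_cst (V W : normedModType R) k (U : set V) (c : W) :
  Ck_on k U (cst c : V -> W).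
Proof.
elim: k c => [|k IH] c /=; first by move=> x _; exact: cst_continuous.
split=> [x _|v]; first exact: differentiable_cst.
rewrite (_ : (fun x => _) = cst 0 :> (V -> W)) //.
by apply/funext => x; rewrite diff_cst.
Qed.

Lemma Ck_on_linear (V W : normedModType R) k (U : set V) (f : {linear V -> W}) :
  continuous f -> Ck_on k U f.
Proof.
move=> cf; case: k => [|k] /=; first by move=> x _; exact: cf.
split=> [x _|v]; first exact: linear_differentiable.
rewrite (_ : (fun x => _) = cst (f v) :> (V -> W)); first exact: Ck_on_cst.
by apply/funext => x; rewrite diff_lin.
Qed.

Lemma Ck_on_comp_linear (V W Z : normedModType R) k (U : set V) (f : V -> W)
    (L : {linear W -> Z}) :
  open U -> continuous L -> Ck_on k U f -> Ck_on k U (L \o f).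
Proof.
move=> oU cL; elim: k f => [|k IH] f /=.
  by move=> cf x Ux; apply: continuous_comp; [exact: cf|exact: cL].
move=> [df dfk]; have dL y : differentiable L y by exact: linear_differentiable.
split=> [x Ux|v]; first by apply: differentiable_comp => //; exact: df.
apply: eq_Ck_on (IH _ (dfk v)) => // x Ux.
by rewrite diff_comp //=; [rewrite diff_lin|exact: df].
Qed.

Lemma Ck_onD (V W : normedModType R) k (U : set V) (f g : V -> W) :
  open U -> Ck_on k U f -> Ck_on k U g -> Ck_on k U (fun x => f x + g x).
Proof.
move=> oU; elim: k f g => [|k IH] f g /=.
  by move=> cf cg x Ux; apply: cvgD; [exact: cf|exact: cg].
move=> [df dfk] [dg dgk]; split=> [x Ux|v].
  by apply: differentiableD; [exact: df|exact: dg].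
apply: eq_Ck_on (IH _ _ (dfk v) (dgk v)) => // x Ux.
exact: (esym (congr1 (@^~ v) (diffD (df _ Ux) (dg _ Ux)))).
Qed.

Lemma Ck_onM (V : normedModType R) k (U : set V) (f g : V -> R^o) :
  open U -> Ck_on k U f -> Ck_on k U g -> Ck_on k U (fun x => f x * g x : R^o).
Proof.
move=> oU; elim: k f g => [|k IH] f g.
  by move=> cf cg x Ux; apply: cvgM; [exact: cf|exact: cg].
move=> Cf Cg; have [df dfk] := Cf; have [dg dgk] := Cg.
split=> [x Ux|v].
  by apply: differentiableM; [exact: df|exact: dg].
have := Ck_onD oU (IH _ _ (Ck_onW Cf) (dgk v)) (IH _ _ (Ck_onW Cg) (dfk v)).
apply: eq_Ck_on => // x Ux.
exact: (esym (congr1 (@^~ v) (diffM (df _ Ux) (dg _ Ux)))).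
Qed.

(** Composition is only needed with an outer function of one variable, where the
    differential of the composite is the product of two scalar functions; this
    avoids the chain rule for outer maps of several variables. *)
Lemma Ck_on_comp1 (V : normedModType R) k (U : set V) (I : set R^o)
    (g : R^o -> R^o) (f : V -> R^o) :
  open U -> Ck_on k I g -> (forall x, U x -> I (f x)) ->
  Ck_on k U f -> Ck_on k U (g \o f).
Proof.
move=> oU; elim: k g f => [|k IH] g f Cg fI Cf.
  by move=> x Ux; apply: continuous_comp; [exact: Cf|apply: Cg; exact: fI].
have [df dfk] := Cf; have [dg dgk] := Cg.
split=> [x Ux|v].
  by apply: differentiable_comp; [exact: df|apply: dg; exact: fI].
have := Ck_onM oU (dfk v) (IH _ _ (dgk 1) fI (Ck_onW Cf)).
apply: eq_Ck_on => // x Ux /=.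
have dgE h : 'd g (f x) h = h * g^`()%classic (f x).
  exact: (congr1 (@^~ h) (diff1E (dg _ (fI _ Ux)))).
apply: etrans (esym (congr1 (@^~ v) (diff_comp (df _ Ux) (dg _ (fI _ Ux))))).
by rewrite /= !dgE mul1r.
Qed.

(** The bootstrap used for functions known through a differential equation: if
    f' is expressed by f, then f is of class C^k for all k by induction. *)
Lemma Ck_on_derive1 k (U : set R^o) (f f' : R^o -> R^o) :
  open U -> (forall x, U x -> is_derive x (1 : R^o) f (f' x)) ->
  Ck_on k U f' -> Ck_on k.+1 U f.
Proof.
move=> oU df Cf'; have df1 x : U x -> differentiable f x.
  by move=> /df[+ _]; move=> /derivable1_diffP.
split=> // v; have := Ck_onM oU (Ck_on_cst k U (v : R^o)) Cf'.
apply: eq_Ck_on => // x Ux /=.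
apply: esym; apply: etrans (congr1 (@^~ v) (diff1E (df1 _ Ux))) _ => /=.
by rewrite derive1E; have [_ ->] := df _ Ux.
Qed.

End CkCalculus.

(** * Smooth maps *)

Section SmoothFunctions.
Context {R : realType}.

Lemma Ck_on_pair (V W Z : normedModType R) k (U : set V) (f : V -> W)
    (g : V -> Z) :
  open U -> Ck_on k U f -> Ck_on k U g ->
  Ck_on k U (fun x => (f x, g x) : (W * Z)%type).
Proof.
move=> oU; elim: k f g => [|k IH] f g.
  by move=> cf cg x Ux; apply: cvg_pair; [exact: cf|exact: cg].
move=> [df dfk] [dg dgk]; split=> [x Ux|v].
  by apply: differentiable_pair; [exact: df|exact: dg].
apply: eq_Ck_on (IH _ _ (dfk v) (dgk v)) => // x Ux.
exact: (esym (congr1 (@^~ v) (diff_pair (df _ Ux) (dg _ Ux)))).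
Qed.

Lemma smooth_on_subset (V W : normedModType R) (A B : set V) (f : V -> W) :
  A `<=` B -> smooth_on B f -> smooth_on A f.
Proof. by move=> AB sf k; apply: Ck_on_subset (sf k). Qed.

Lemma smooth_on_cst (V W : normedModType R) (U : set V) (c : W) :
  smooth_on U (fun _ : V => c).
Proof. by move=> k; exact: Ck_on_cst. Qed.

Lemma smooth_onD (V W : normedModType R) (U : set V) (f g : V -> W) :
  open U -> smooth_on U f -> smooth_on U g -> smooth_on U (fun x => f x + g x).
Proof. by move=> oU sf sg k; apply: Ck_onD. Qed.

Lemma smooth_on_sum (V W : normedModType R) (U : set V) (I : Type) (r : seq I)
    (f : I -> V -> W) :
  open U -> (forall i, smooth_on U (f i)) ->
  smooth_on U (fun x => \sum_(i <- r) f i x).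
Proof.
move=> oU sf; elim: r => [|i r IH].
  rewrite (_ : (fun x => _) = (fun=> 0)); first exact: smooth_on_cst.
  by apply/funext => x; rewrite big_nil.
rewrite (_ : (fun x => _) = (fun x => f i x + \sum_(j <- r) f j x)).
  exact: smooth_onD.
by apply/funext => x; rewrite big_cons.
Qed.

Lemma smooth_onM (V : normedModType R) (U : set V) (f g : V -> R^o) :
  open U -> smooth_on U f -> smooth_on U g ->
  smooth_on U (fun x => f x * g x : R^o).
Proof. by move=> oU sf sg k; apply: Ck_onM. Qed.

Lemma smooth_on_comp1 (V : normedModType R) (U : set V) (I : set R^o)
    (g : R^o -> R^o) (f : V -> R^o) :
  open U -> smooth_on I g -> (forall x, U x -> I (f x)) -> smooth_on U f ->
  smooth_on U (fun x => g (f x)).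
Proof. by move=> oU sg fI sf k; apply: (Ck_on_comp1 oU (sg k) fI). Qed.

Lemma smooth_on_scale (V W : normedModType R) (U : set V) (f : V -> R^o)
    (w : W) :
  open U -> smooth_on U f -> smooth_on U (fun x => f x *: w).
Proof.
move=> oU sf k.
have sx_lin : linear ( *:%R ^~ w : R^o -> W).
  by move=> u y z; rewrite scalerDl scalerA.
pose sxlM := GRing.isLinear.Build _ _ _ _ _ sx_lin.
pose sxL : {linear R^o -> W} := HB.pack ( *:%R ^~ w) sxlM.
have cL : continuous sxL by exact: scalel_continuous.
exact: (@Ck_on_comp_linear R V R^o W k U f sxL oU cL (sf k)).
Qed.

Lemma smooth_on_mx (V : normedModType R) m n (U : set V)
    (F : V -> 'M[R]_(m.+1, n.+1)) :
  open U -> (forall i j, smooth_on U (fun x => F x i j : R^o)) ->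
  smooth_on U F.
Proof.
move=> oU sF.
rewrite (_ : F = fun x => \sum_i \sum_j F x i j *: delta_mx i j); last first.
  by apply/funext => x; rewrite -matrix_sum_delta.
by do 2 (apply: smooth_on_sum => // ?); exact: smooth_on_scale.
Qed.

Lemma smooth_on_id (W : normedModType R) (U : set W) : smooth_on U (id : W -> W).
Proof. by move=> k; apply: (@Ck_on_linear R W W k U idfun) => x; exact: cvg_id. Qed.

Lemma smooth_on_fst (W Z : normedModType R) (U : set (W * Z)) :
  smooth_on U (fst : W * Z -> W).
Proof. by move=> k; apply: (@Ck_on_linear R _ W k U fst) => x; exact: cvg_fst. Qed.

Lemma smooth_on_snd (W Z : normedModType R) (U : set (W * Z)) :
  smooth_on U (snd : W * Z -> Z).
Proof. by move=> k; apply: (@Ck_on_linear R _ Z k U snd) => x; exact: cvg_snd. Qed.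

Lemma smooth_on_continuous (V W : normedModType R) (f : V -> W) :
  smooth_on setT f -> continuous f.
Proof. by move=> /(_ 0%N) cf x; exact: cf. Qed.

Lemma smooth_on_inv : smooth_on [set x : R^o | x != 0] (fun x => x^-1 : R^o).
Proof.
have oU : open [set x : R^o | x != 0] by exact: open_neq.
elim=> [|k IH] /=; first by move=> x /= x0; exact: inv_continuous.
apply: (@Ck_on_derive1 _ _ _ _ (fun x => - 1 * (x^-1 * x^-1))) => //.
  move=> x /= x0; apply: is_derive_eq (is_deriveV (f := id) x0 _) _.
  by rewrite scaler1 expr2 invfM mulN1r.
by apply: Ck_onM => //; [exact: Ck_on_cst|exact: Ck_onM].
Qed.

Lemma smooth_on_sqrt : smooth_on [set x : R^o | 0 < x] (@Num.sqrt R : R^o -> R^o).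
Proof.
have oU : open [set x : R^o | 0 < x] by exact: open_gt.
elim=> [|k IH]; first by move=> x /= x0; exact: sqrt_continuous.
apply: (@Ck_on_derive1 _ _ _ _ (fun x => (2 * Num.sqrt x)^-1)) => //.
apply: (@Ck_on_comp1 _ _ _ _ [set x : R^o | x != 0] (fun x => x^-1 : R^o)) => //.
- exact: smooth_on_inv.
- by move=> x /= x0; rewrite mulf_neq0// gt_eqF// sqrtr_gt0.
- by apply: Ck_onM => //; exact: Ck_on_cst.
Qed.

Lemma smooth_on_sin_cos (U : set R^o) :
  smooth_on U (@sin R : R^o -> R^o) /\ smooth_on U (@cos R : R^o -> R^o).
Proof.
suff H k : Ck_on k [set: R^o] (@sin R : R^o -> R^o) /\
            Ck_on k [set: R^o] (@cos R : R^o -> R^o).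
  by split=> k; apply: Ck_on_subset (subsetT U) _; have [] := H k.
elim: k => [|k [IHs IHc]].
  by split=> x _; [exact: continuous_sin|exact: continuous_cos].
split; first by apply: (Ck_on_derive1 openT) IHc => x _; exact: is_derive_sin.
apply: (@Ck_on_derive1 _ _ _ _ (fun x => - 1 * sin x) (openT)).
  by move=> x _; rewrite mulN1r; exact: is_derive_cos.
by apply: (Ck_onM openT) IHs; exact: Ck_on_cst.
Qed.

(** The derivative of the inverse is g' = 1 / (f' o g), from which the regularity
    of g is bootstrapped. *)
Lemma smooth_inverse (J : set R^o) (f f' g : R^o -> R^o) :
  open J -> (forall x, J x -> is_derive x (1 : R^o) f (f' x)) ->
  smooth_on J f' -> (forall x, J x -> f' x != 0) ->
  (forall x, J x -> g (f x) = x) ->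
  open (f @` J) /\ smooth_on (f @` J) g.
Proof.
move=> oJ df sf' f'0 fK.
have nJ x : J x -> \forall y \near x, J y.
  by move=> Jx; exact: open_nbhs_nbhs (conj oJ Jx).
have nC x : J x -> {near x, continuous f}.
  move=> /nJ; apply: filterS => y /df[+ _].
  by move=> /derivable1_diffP /differentiable_continuous.
have nK x : J x -> {near x, cancel f g} by move=> /nJ; apply: filterS => y /fK.
have ofJ : open (f @` J).
  rewrite openE => _ [x Jx <-]; rewrite /interior /=.
  have fgK := near_continuous_can_sym (nC _ Jx) (nK _ Jx).
  have gc := nbhs_singleton (near_can_continuous (nK _ Jx) (nC _ Jx)).
  have gJ : \forall y \near f x, J (g y) by apply: gc; rewrite fK //; exact: nJ.
  by apply: filterS2 gJ fgK => y Jgy fgy; exists (g y).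
split=> // ; elim=> [|k IH].
  move=> _ [x Jx <-].
  exact: nbhs_singleton (near_can_continuous (nK _ Jx) (nC _ Jx)).
apply: (@Ck_on_derive1 _ _ _ _ (fun y => (f' (g y))^-1)) => //.
  move=> _ [x Jx <-]; rewrite fK //.
  by apply: is_derive_inverse (df _ Jx) (f'0 _ Jx); [exact: nK|exact: nC].
apply: (@Ck_on_comp1 _ _ _ _ J (fun z => (f' z)^-1)) IH => //; last first.
  by move=> _ [x Jx <-]; rewrite fK.
by apply: (Ck_on_comp1 oJ (smooth_on_inv k) f'0); exact: sf'.
Qed.

End SmoothFunctions.

Section SmoothMatrices.
Context {R : realType} (V : normedModType R) (U : set V) (oU : open U).
Implicit Types (F G : V -> 'M[R]_3) (f g : V -> R^o).

Lemma smooth_entry F i j : smooth_on U F -> smooth_on U (fun x => F x i j : R^o).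
Proof.
move=> sF k.
have lin : linear (fun A : 'M[R]_3 => A i j : R^o).
  by move=> a A B; rewrite !mxE.
pose M := GRing.isLinear.Build _ _ _ _ _ lin.
pose L : {linear 'M[R]_3 -> R^o} := HB.pack (fun A : 'M[R]_3 => A i j) M.
have cL : continuous L by exact: coord_continuous.
exact: (@Ck_on_comp_linear R _ _ _ k U F L oU cL (sF k)).
Qed.

Lemma smooth_mxM F G : smooth_on U F -> smooth_on U G ->
  smooth_on U (fun x => F x *m G x).
Proof.
move=> sF sG; apply: smooth_on_mx => // i j.
rewrite (_ : (fun x => _) = fun x => \sum_k F x i k * G x k j); last first.
  by apply/funext => x; rewrite mxE.
by apply: smooth_on_sum => // k; apply: smooth_onM => //; exact: smooth_entry.
Qed.

Lemma smooth_mxT F : smooth_on U F -> smooth_on U (fun x => (F x)^T).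
Proof.
move=> sF; apply: smooth_on_mx => // i j.
rewrite (_ : (fun x => _) = fun x => F x j i); first exact: smooth_entry.
by apply/funext => x; rewrite mxE.
Qed.

Lemma smooth_edot F G : smooth_on U F -> smooth_on U G ->
  smooth_on U (fun x => edot (F x) (G x) : R^o).
Proof.
move=> sF sG; do 2 (apply: smooth_on_sum => // ?).
by apply: smooth_onM => //; exact: smooth_entry.
Qed.

Lemma smooth_mxZ f F : smooth_on U f -> smooth_on U F ->
  smooth_on U (fun x => f x *: F x).
Proof.
move=> sf sF; apply: smooth_on_mx => // i j.
rewrite (_ : (fun x => _) = fun x => f x * F x i j); last first.
  by apply/funext => x; rewrite mxE.
by apply: smooth_onM => //; exact: smooth_entry.
Qed.

Lemma smooth_cstM (c : R) f : smooth_on U f -> smooth_on U (fun x => c * f x : R^o).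
Proof. by move=> sf; apply: smooth_onM => //; exact: smooth_on_cst. Qed.

Lemma smooth_inv f : (forall x, U x -> f x != 0) -> smooth_on U f ->
  smooth_on U (fun x => (f x)^-1 : R^o).
Proof. by move=> f0 sf; exact: (smooth_on_comp1 oU smooth_on_inv f0). Qed.

Lemma smooth_sqrt f : (forall x, U x -> 0 < f x) -> smooth_on U f ->
  smooth_on U (fun x => Num.sqrt (f x) : R^o).
Proof. by move=> f0 sf; exact: (smooth_on_comp1 oU smooth_on_sqrt f0). Qed.

End SmoothMatrices.

(** * Trigonometric functions of the square of the angle *)

Section Trigonometry.
Context {R : realType}.

(** The coefficients of an entire function of exponential type. The bound is
    stable by formal differentiation, so the sum of the series is smooth. *)
Definition exp_bounded (c : R^nat) :=
  exists K M, forall n, `|c n| <= K * (M ^+ n / n`!%:R).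

Lemma exp_bounded_cvg c (x : R) : exp_bounded c -> cvgn (pseries c x).
Proof.
move=> [K [M cKM]]; apply: normed_cvg.
have K0 : 0 <= K.
  by have := cKM 0%N; rewrite expr0 fact0 divr1 mulr1; apply: le_trans.
have KM0 n : 0 <= K * (M ^+ n / n`!%:R) by apply: le_trans (cKM n).
have xn0 n : 0 <= `|x| ^+ n by rewrite exprn_ge0.
apply: (@series_le_cvg _ _ (fun n => K * exp_coeff (M * `|x|) n)) => //.
- by move=> n; exact: normr_ge0.
- by move=> n; rewrite /exp_coeff /= exprMn mulrAC mulrA mulr_ge0.
- move=> n /=; rewrite normrM normrX /exp_coeff /= exprMn mulrAC mulrA.
  exact: ler_wpM2r.
exact: (@is_cvg_seriesZ _ (exp_coeff (M * `|x|) : R^o^nat) K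
  (is_cvg_series_exp_coeff (M * `|x|))).
Qed.

Lemma exp_bounded_diffs c : exp_bounded c -> exp_bounded (pseries_diffs c).
Proof.
move=> [K [M cKM]]; exists (K * M), M => n.
rewrite /pseries_diffs normrM normr_nat.
apply: le_trans (ler_wpM2l _ (cKM n.+1)) _ => //.
rewrite factS natrM exprS le_eqVlt; apply/orP; left; apply/eqP.
have n0 : n.+1%:R != 0 :> R by rewrite pnatr_eq0.
have f0 : n`!%:R != 0 :> R by rewrite pnatr_eq0 -lt0n fact_gt0.
by field; rewrite f0 nat1r n0.
Qed.

Lemma is_derive_pseries c (x : R) : exp_bounded c ->
  is_derive x (1 : R) (fun x => limn (pseries c x))
    (limn (pseries (pseries_diffs c) x)).
Proof.
move=> cb; have db := exp_bounded_diffs cb; have ddb := exp_bounded_diffs db.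
apply: (@pseries_snd_diffs _ c (`|x| + 1)); do ?exact: exp_bounded_cvg.
by rewrite [ltRHS]ger0_norm ?addr_ge0// ltrDl.
Qed.

Lemma smooth_pseries c : exp_bounded c ->
  smooth_on [set: R^o] (fun x : R^o => limn (pseries c x) : R^o).
Proof.
move=> + k; elim: k c => [|k IH] c cb.
  move=> x _; apply: differentiable_continuous; apply/derivable1_diffP.
  by have [] := is_derive_pseries x cb.
apply: (@Ck_on_derive1 _ _ _ _ (fun x => limn (pseries (pseries_diffs c) x))).
- exact: openT.
- by move=> x _; exact: is_derive_pseries.
- exact: IH (exp_bounded_diffs cb).
Qed.

(** The entire functions with cosq (t^2) = cos t and t * sincq (t^2) = sin t; in
    particular sincq 0 = 1. *)
Definition cosq (y : R) : R := limn (pseries (fun n => (-1) ^+ n / n.*2`!%:R) y).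
Definition sincq_coeff : R^nat := fun n => (-1) ^+ n / n.*2.+1`!%:R.
Definition sincq (y : R) : R := limn (pseries sincq_coeff y).
Definition sincq' (y : R) : R := limn (pseries (pseries_diffs sincq_coeff) y).

Lemma exp_bounded_alt (u : nat -> nat) : (forall n, n <= u n)%N ->
  exp_bounded (fun n => (-1) ^+ n / (u n)`!%:R).
Proof.
move=> nu; exists 1, 1 => n; rewrite normrM normrX normrN1 !expr1n !mul1r.
rewrite ger0_norm ?invr_ge0// lef_pV2 ?posrE ?ltr0n ?fact_gt0//.
by rewrite ler_nat leq_fact.
Qed.

Lemma exp_bounded_sincq : exp_bounded sincq_coeff.
Proof. by apply: exp_bounded_alt => n; rewrite -addnn -addnS leq_addr. Qed.

Lemma smooth_cosq (U : set R^o) : smooth_on U (cosq : R^o -> R^o).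
Proof.
apply: smooth_on_subset (subsetT U) _; apply: smooth_pseries.
by apply: exp_bounded_alt => n; rewrite -addnn leq_addr.
Qed.

Lemma smooth_sincq (U : set R^o) : smooth_on U (sincq : R^o -> R^o).
Proof.
apply: smooth_on_subset (subsetT U) _; apply: smooth_pseries.
exact: exp_bounded_sincq.
Qed.

Lemma cosqE t : cosq (t ^+ 2) = cos t.
Proof.
apply/cvg_lim => //; have := @cvg_cos_coeff' R t.
rewrite (_ : cos_coeff' t = fun n => (-1) ^+ n / n.*2`!%:R * t ^+ 2 ^+ n) //.
by apply/funext => n; rewrite /cos_coeff' -exprM mul2n mulrAC.
Qed.

Lemma sincqE t : t * sincq (t ^+ 2) = sin t.
Proof.
have := @cvg_sin_coeff' R t.
rewrite (_ : sin_coeff' t =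
    fun n => t * (sincq_coeff n * t ^+ 2 ^+ n)); last first.
  apply/funext => n; rewrite /sin_coeff' -exprM mul2n exprS /sincq_coeff.
  by rewrite -[_ ^ _]/((-1) ^+ n); ring.
move=> /cvg_lim <- //; rewrite /sincq.
have := @exp_bounded_cvg _ (t ^+ 2) exp_bounded_sincq.
by move=> /(lim_seriesZ t) /esym.
Qed.

Lemma is_derive_sincq (y : R) : is_derive y (1 : R) sincq (sincq' y).
Proof. exact: is_derive_pseries exp_bounded_sincq. Qed.

(** Differentiate t * sincq (t^2) = sin t. *)
Lemma sincq'E t : sincq (t ^+ 2) + 2 * t ^+ 2 * sincq' (t ^+ 2) = cos t.
Proof.
have d1 : is_derive t (1 : R) (@sin R) (cos t) by exact: is_derive_sin.
have dX : is_derive t (1 : R) (fun t => t ^+ 2) (2 * t).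
  by split; [exact: exprn_derivable|rewrite exp_derive expr1 scaler1].
have dS := is_derive1_comp (g := fun s => s ^+ 2) (is_derive_sincq (t ^+ 2)) dX.
have := is_deriveM (is_derive_id t 1) dS.
rewrite (_ : id * _ = sin); last by apply/funext => s; rewrite -sincqE.
move=> [_ E]; have [_ <-] := d1; rewrite E /= scaler1.
by rewrite /GRing.scale /=; ring.
Qed.

(** The square of sin t as a function of y = t^2, and its derivative. *)
Definition sin2q (y : R) : R := y * sincq y ^+ 2.
Definition sin2q' (y : R) : R := sincq y * (sincq y + 2 * y * sincq' y).

Lemma smooth_sin2q' (U : set R^o) : smooth_on U (sin2q' : R^o -> R^o).
Proof.
apply: smooth_on_subset (subsetT U) _; have oT := @openT R^o.
have sS' : smooth_on [set: R^o] (sincq' : R^o -> R^o).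
  exact: smooth_pseries (exp_bounded_diffs exp_bounded_sincq).
have sid := @smooth_on_id R R^o setT.
apply: smooth_onM => //; first exact: smooth_sincq.
apply: smooth_onD => //; first exact: smooth_sincq.
by do 2 (apply: smooth_onM => //); exact: smooth_on_cst.
Qed.

Lemma is_derive_sin2q (y : R) : is_derive y (1 : R) sin2q (sin2q' y).
Proof.
have dS := is_derive_sincq y.
have := is_deriveM (is_derive_id y 1) (is_deriveX 2 dS).
rewrite (_ : id * _ = sin2q) // => dM; apply: is_derive_eq dM _.
rewrite /sin2q' scaler1 /GRing.scale /= -[(_ ^+ 2) y]/(sincq y ^+ 2); ring.
Qed.

Lemma sin2q'_gt0 t : 0 <= t < pi / 4 -> 0 < sin2q' (t ^+ 2).
Proof.
move=> /andP[t0 t4]; have pi0 := pi_gt0 R.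
rewrite /sin2q' sincq'E mulr_gt0//; last by apply: cos_gt0_pihalf; lra.
have [->|t_neq0] := eqVneq t 0.
  by have := sincq'E 0; rewrite expr0n /= mulr0 mul0r addr0 cos0 => ->.
have tpos : 0 < t by rewrite lt0r t_neq0.
rewrite -(pmulr_rgt0 _ tpos) sincqE; apply: sin_gt0_pihalf; lra.
Qed.

(** The ratio t / sin t as a smooth function of sin(t)^2, on an open set that
    contains 0. The function [sin2q] has a positive derivative on [0, (pi/4)^2),
    hence on an interval that starts a little before 0, and the ratio is
    1 / sincq composed with its inverse. *)
Lemma smooth_angle_ratio : exists (I : set R^o) (r : R^o -> R^o),
  [/\ open I, smooth_on I r &
      forall t, 0 <= t < pi / 4 -> I (sin t ^+ 2) /\ r (sin t ^+ 2) * sin t = t].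
Proof.
have pi0 := pi_gt0 R; pose b : R := (pi / 4) ^+ 2.
have b0 : 0 < b by rewrite exprn_gt0 // divr_gt0.
have [e e0 epos] : exists2 e : R, 0 < e & forall y, - e < y < b -> 0 < sin2q' y.
  (* below 0 the sign follows from continuity, above 0 from the formula *)
  have c0 : \forall y \near (0 : R^o), 0 < sin2q' y.
    have c2 := smooth_on_continuous (@smooth_sin2q' setT).
    apply: (@cvgr_gt _ _ _ _ _ _ (c2 (0 : R^o))).
    by have := @sin2q'_gt0 0; rewrite expr0n; apply; rewrite lexx divr_gt0.
  have /nbhs_ballP[e /= e0 eS] := c0; exists e => // y /andP[ey yb].
  have [y0|y0] := ltP y 0.
    by apply: eS; rewrite /ball /= sub0r normrN ltr0_norm // ltrNl.
  rewrite -(sqr_sqrtr y0); apply: sin2q'_gt0; rewrite sqrtr_ge0 /=.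
  by rewrite -(@ger0_norm _ (pi / 4)) ?divr_ge0 ?ltW// -sqrtr_sqr ltr_sqrt.
pose J := [set y : R^o | - e < y < b].
have JE : J = `]- e, b[%classic by apply/seteqP; split=> y; rewrite /J /= in_itv.
have oJ : open J by rewrite JE; exact: itv_open.
have injJ : {in J &, injective sin2q}.
  have inc : {in `]- e, b[%R &, {homo sin2q : x y / x < y}}.
    apply: gtr0_derive1_lt_oo => x.
    - by move=> _; have [] := is_derive_sin2q x.
    - rewrite in_itv /= => xJ; rewrite derive1E.
      by have [_ ->] := is_derive_sin2q x; exact: epos.
    - move=> _; apply: differentiable_continuous; apply/derivable1_diffP.
      by have [] := is_derive_sin2q x.
  move=> x y /set_mem Jx /set_mem Jy xy.
  have inc' u v : J u -> J v -> u < v -> sin2q u < sin2q v.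
    by move=> Ju Jv; apply: inc; rewrite in_itv.
  have [uv|uv|//] := ltgtP x y.
    by have := inc' _ _ Jx Jy uv; rewrite xy ltxx.
  by have := inc' _ _ Jy Jx uv; rewrite xy ltxx.
pose g (x : R^o) : R^o := xget 0 [set y | J y /\ sin2q y = x].
have gK y : J y -> g (sin2q y) = y.
  move=> Jy; rewrite /g; case: xgetP => [z _ [Jz zy]|/(_ y)[]//].
  by apply: injJ; rewrite ?inE.
have [oI sg] := smooth_inverse oJ (fun x _ => is_derive_sin2q x)
  (@smooth_sin2q' J) (fun x Jx => lt0r_neq0 (epos x Jx)) gK.
have S0 y : J y -> sincq y != 0.
  by move=> /epos; apply: contraTneq => S0; rewrite /sin2q' S0 mul0r ltxx.
exists (sin2q @` J), (fun x => (sincq (g x))^-1); split=> //.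
  apply: (@smooth_on_comp1 _ _ _ [set x : R^o | x != 0] (fun x => x^-1)) => //.
  - exact: smooth_on_inv.
  - by move=> _ [y Jy <-]; rewrite gK //; exact: S0.
  - by apply: (smooth_on_comp1 oI (@smooth_sincq setT)).
move=> t /[dup] ht /andP[t0 t4].
have Jt : J (t ^+ 2).
  rewrite /J /= (lt_le_trans _ (sqr_ge0 t)) ?oppr_lt0//=.
  by rewrite ltrXn2r //; lra.
have sE : sin t ^+ 2 = sin2q (t ^+ 2) by rewrite /sin2q -sincqE exprMn.
rewrite sE gK //; split; first by exists (t ^+ 2).
by rewrite -sincqE mulrCA mulVf ?mulr1 // S0.
Qed.

End Trigonometry.

(** * Matrices of size 3 given by their entries *)

Section ThreeByThree.
Context {R : realType}.
Implicit Types A B U V : 'M[R]_3.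

(** Matrix identities become one polynomial identity for each entry once both
    sides have this form. *)
Definition mx3 (a b c d e f g h i : R) : 'M[R]_3 :=
  \matrix_(k, l) nth 0 (nth [::] [:: [:: a; b; c]; [:: d; e; f]; [:: g; h; i]] k) l.

Lemma sum3 (F : 'I_3 -> R) : \sum_i F i = F 0 + F 1 + F 2.
Proof.
rewrite !big_ord_recl big_ord0 addr0 addrA.
by congr (F _ + F _ + F _); apply/val_inj.
Qed.

Lemma mx3P A B :
  A 0 0 = B 0 0 -> A 0 1 = B 0 1 -> A 0 2 = B 0 2 ->
  A 1 0 = B 1 0 -> A 1 1 = B 1 1 -> A 1 2 = B 1 2 ->
  A 2 0 = B 2 0 -> A 2 1 = B 2 1 -> A 2 2 = B 2 2 -> A = B.
Proof.
move=> *; apply/matrixP => i j.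
have ord3 (k : 'I_3) : [\/ k = 0, k = 1 | k = 2].
  case: k => [[|[|[|//]]] ?];
    [constructor 1|constructor 2|constructor 3]; exact: val_inj.
by case: (ord3 i) => ->; case: (ord3 j) => ->.
Qed.

Lemma mx3E A : A = mx3 (A 0 0) (A 0 1) (A 0 2) (A 1 0) (A 1 1) (A 1 2)
  (A 2 0) (A 2 1) (A 2 2).
Proof. by apply: mx3P; rewrite !mxE. Qed.

Lemma mx3M a b c d e f g h i a' b' c' d' e' f' g' h' i' :
  mx3 a b c d e f g h i *m mx3 a' b' c' d' e' f' g' h' i' =
  mx3 (a * a' + b * d' + c * g') (a * b' + b * e' + c * h') (a * c' + b * f' + c * i')
      (d * a' + e * d' + f * g') (d * b' + e * e' + f * h') (d * c' + e * f' + f * i')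
      (g * a' + h * d' + i * g') (g * b' + h * e' + i * h') (g * c' + h * f' + i * i').
Proof. by apply: mx3P; rewrite !mxE sum3 !mxE. Qed.

Lemma mx3T a b c d e f g h i :
  (mx3 a b c d e f g h i)^T = mx3 a d g b e h c f i.
Proof. by apply: mx3P; rewrite !mxE. Qed.

Lemma mx3D a b c d e f g h i a' b' c' d' e' f' g' h' i' :
  mx3 a b c d e f g h i + mx3 a' b' c' d' e' f' g' h' i' =
  mx3 (a + a') (b + b') (c + c') (d + d') (e + e') (f + f') (g + g') (h + h') (i + i').
Proof. by apply: mx3P; rewrite !mxE. Qed.

Lemma mx3Z k a b c d e f g h i : k *: mx3 a b c d e f g h i =
  mx3 (k * a) (k * b) (k * c) (k * d) (k * e) (k * f) (k * g) (k * h) (k * i).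
Proof. by apply: mx3P; rewrite !mxE. Qed.

Lemma mx3_1 : 1%:M = mx3 1 0 0 0 1 0 0 0 1.
Proof. by apply: mx3P; rewrite !mxE. Qed.

Lemma mx3_0 : 0 = mx3 0 0 0 0 0 0 0 0 0.
Proof. by apply: mx3P; rewrite !mxE. Qed.

Lemma edot_mx3 a b c d e f g h i a' b' c' d' e' f' g' h' i' :
  edot (mx3 a b c d e f g h i) (mx3 a' b' c' d' e' f' g' h' i') =
  a * a' + b * b' + c * c' + (d * d' + e * e' + f * f') + (g * g' + h * h' + i * i').
Proof. by rewrite /edot !sum3 !mxE. Qed.

Lemma det_mx3 a b c d e f g h i : \det (mx3 a b c d e f g h i) =
  a * (e * i - f * h) - b * (d * i - f * g) + c * (d * h - e * g).
Proof.
rewrite (expand_det_row _ 0) sum3 /cofactor.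
rewrite !(@expand_det_row _ 2 _ 0) !big_ord_recl !big_ord0 /cofactor !det_mx11.
rewrite !mxE /= /bump /=; ring.
Qed.

End ThreeByThree.

(** * Orthogonal matrices and the Euclidean structure *)

Section Frames.
Context {R : realType}.
Implicit Types A B U V : 'M[R]_3.

Definition orth U := U^T *m U = 1%:M.

Lemma orthC U : orth U -> U *m U^T = 1%:M.
Proof. exact: mulmx1C. Qed.

Lemma orth_tr U : orth U -> orth U^T.
Proof. by move=> oU; rewrite /orth trmxK orthC. Qed.

Lemma orthM U V : orth U -> orth V -> orth (U *m V).
Proof. by move=> oU oV; rewrite /orth trmx_mul mulmxA -(mulmxA V^T) oU mulmx1. Qed.

Lemma orth1 : orth (1%:M : 'M[R]_3).
Proof. by rewrite /orth trmx1 mulmx1. Qed.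

Lemma edotE m n (A B : 'M[R]_(m, n)) : edot A B = \tr (A^T *m B).
Proof.
rewrite /edot exchange_big /mxtrace; apply: eq_bigr => j _.
by rewrite !mxE; apply: eq_bigr => i _; rewrite !mxE.
Qed.

Lemma edotC m n (A B : 'M[R]_(m, n)) : edot A B = edot B A.
Proof. by rewrite /edot; do 2 (apply: eq_bigr => ? _); rewrite mulrC. Qed.

Lemma edotDr m n (A B C : 'M[R]_(m, n)) : edot A (B + C) = edot A B + edot A C.
Proof. by rewrite !edotE mulmxDr mxtraceD. Qed.

Lemma edotZr m n (A B : 'M[R]_(m, n)) k : edot A (k *: B) = k * edot A B.
Proof. by rewrite !edotE -scalemxAr mxtraceZ. Qed.

Lemma edotDl m n (A B C : 'M[R]_(m, n)) : edot (A + B) C = edot A C + edot B C.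
Proof. by rewrite edotC edotDr !(edotC C). Qed.

Lemma edotZl m n (A B : 'M[R]_(m, n)) k : edot (k *: A) B = k * edot A B.
Proof. by rewrite edotC edotZr edotC. Qed.

Lemma edot_ge0 m n (A : 'M[R]_(m, n)) : 0 <= edot A A.
Proof. by do 2 (apply: sumr_ge0 => ? _); rewrite -expr2 sqr_ge0. Qed.

Lemma edot_eq0 m n (A : 'M[R]_(m, n)) : edot A A = 0 -> A = 0.
Proof.
rewrite /edot => /eqP A0; apply/matrixP => i j; rewrite mxE; apply/eqP.
have s0 k : 0 <= \sum_l A k l * A k l by apply: sumr_ge0 => l _; rewrite -expr2 sqr_ge0.
move: A0; rewrite psumr_eq0 => [/allP /(_ i)|k _]; last exact: s0.
rewrite mem_index_enum => /(_ isT); rewrite psumr_eq0 => [/allP /(_ j)|l _].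
  by rewrite mem_index_enum => /(_ isT); rewrite mulf_eq0 orbb.
by rewrite -expr2 sqr_ge0.
Qed.

Lemma enormE m n (A : 'M[R]_(m, n)) : enorm A = Num.sqrt (edot A A).
Proof. by []. Qed.

Lemma enorm_sqr m n (A : 'M[R]_(m, n)) : enorm A ^+ 2 = edot A A.
Proof. by rewrite enormE sqr_sqrtr // edot_ge0. Qed.

Lemma enorm_ge0 m n (A : 'M[R]_(m, n)) : 0 <= enorm A.
Proof. exact: sqrtr_ge0. Qed.

Lemma enormP m n (A : 'M[R]_(m, n)) k : 0 <= k ->
  (enorm A = Num.sqrt k <-> edot A A = k).
Proof.
move=> k0; split=> [E|]; last by rewrite enormE => ->.
by rewrite -enorm_sqr E sqr_sqrtr.
Qed.

Lemma edot_orth U V A B : orth U -> orth V ->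
  edot (U *m A *m V^T) (U *m B *m V^T) = edot A B.
Proof.
move=> oU oV; rewrite !edotE !trmx_mul trmxK mxtrace_mulC.
rewrite !mulmxA -[_ *m V^T *m V]mulmxA oV mulmx1.
by rewrite -mulmxA mxtrace_mulC -!mulmxA (mulmxA U^T) oU mul1mx mxtrace_mulC.
Qed.

Lemma orth_frameK U V A : orth U -> orth V ->
  U^T *m (U *m A *m V^T) *m V = A.
Proof.
by move=> oU oV; rewrite !mulmxA oU mul1mx -mulmxA oV mulmx1.
Qed.

Lemma orth_frameKV U V A : orth U -> orth V ->
  U *m (U^T *m A *m V) *m V^T = A.
Proof.
by move=> /orthC oU /orthC oV; rewrite !mulmxA oU mul1mx -mulmxA oV mulmx1.
Qed.

Lemma frame_cube U V A : orth U -> orth V ->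
  (U *m A *m V^T) *m (U *m A *m V^T)^T *m (U *m A *m V^T) =
  U *m (A *m A^T *m A) *m V^T.
Proof.
move=> oU oV; rewrite !trmx_mul trmxK !mulmxA.
by rewrite -[_ *m V^T *m V]mulmxA oV mulmx1 -[_ *m U^T *m U]mulmxA oU mulmx1.
Qed.

Definition axis3 : 'cV[R]_3 := delta_mx 2 0.

(** The reflection that exchanges the third basis vector and w, unless they are
    equal. *)
Lemma orth_completion (w : 'cV[R]_3) : w^T *m w = 1%:M ->
  exists2 V, orth V & V *m axis3 = w.
Proof.
move=> w1; have [->|wne] := eqVneq w axis3.
  by exists 1%:M; [exact: orth1|rewrite mul1mx].
have e33 : axis3^T *m axis3 = 1%:M.
  by rewrite /axis3 trmx_delta mul_delta_mx; apply/matrixP => i j;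
    rewrite !mxE !ord1 !eqxx.
have we : exists z, w^T *m axis3 = z%:M /\ axis3^T *m w = z%:M.
  exists (w 2 0); split; apply/matrixP => i j; rewrite !ord1 !mxE sum3 !mxE /=; ring.
have [z [we1 we2]] := we.
(* the reflection along h, with |h|^2 = 2 (1 - z) *)
pose h := axis3 - w; have hT : h^T = axis3^T - w^T by rewrite /h linearB.
have hh : h^T *m h = (2 * (1 - z))%:M.
  rewrite hT /h mulmxBl !mulmxBr e33 w1 we1 we2.
  by apply/matrixP => i j; rewrite !ord1 !mxE /=; ring.
have z1 : 1 - z != 0.
  apply: contraNneq wne => z1; rewrite eq_sym -subr_eq0; apply/eqP.
  by apply: edot_eq0; rewrite edotE -/h hh z1 mulr0 raddf0 mxtrace0.
pose V := 1%:M - (1 - z)^-1 *: (h *m h^T).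
have VT : V^T = V by rewrite /V linearB /= linearZ /= trmx1 trmx_mul trmxK.
exists V.
  have : h *m h^T *m (h *m h^T) = (2 * (1 - z)) *: (h *m h^T).
    by rewrite mulmxA -(mulmxA h) hh mul_mx_scalar -scalemxAl.
  rewrite /orth VT /V; move: (h *m h^T) => M MM.
  rewrite mulmxBl !mulmxBr mul1mx !mulmx1 mul1mx -scalemxAl -scalemxAr MM.
  by apply/matrixP => i j; rewrite !mxE; field.
rewrite /V mulmxBl mul1mx -scalemxAl -mulmxA.
have -> : h^T *m axis3 = (1 - z)%:M.
  by rewrite hT mulmxBl e33 we1; apply/matrixP => i j; rewrite !ord1 !mxE.
by rewrite mul_mx_scalar scalerA mulVf // scale1r /h opprB addrC subrK.
Qed.

End Frames.

(** * Best matrices of rank 2 *)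

Section BestMatrices.
Context {R : realType}.
Implicit Types A B U V P : 'M[R]_3.

Definition dotfun (w u : 'cV[R]_3) : R^o := edot w u.

Lemma dotfun_linear w : linear (dotfun w).
Proof. by move=> k u v; rewrite /dotfun edotDr edotZr. Qed.

HB.instance Definition _ w :=
  GRing.isLinear.Build R 'cV[R]_3 R^o *:%R (dotfun w) (dotfun_linear w).

Definition perp (w : 'cV[R]_3) : {vspace 'cV[R]_3} := lker (linfun (dotfun w)).

Lemma mem_perp w u : (u \in perp w) = (edot w u == 0).
Proof. by rewrite memv_ker lfunE. Qed.

Lemma dim_perp w : edot w w != 0 -> \dim (perp w) = 2%N.
Proof.
move=> w0; have := limg_ker_dim (linfun (dotfun w)) fullv.
rewrite capfv -/(perp w) dimvf /dim /= => /eqP.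
rewrite (_ : \dim (limg _) = 1%N); first by rewrite addn1 muln1 => /eqP[].
apply/eqP; rewrite eqn_leq; apply/andP; split.
  by apply: leq_trans (dimvS (subvf _)) _; rewrite dimvf.
rewrite lt0n dimv_eq0; apply: contraNneq w0 => l0.
have : linfun (dotfun w) w \in limg (linfun (dotfun w)) by rewrite memv_img ?memvf.
by rewrite l0 memv0 lfunE.
Qed.

(** Polarization on the basis vectors. *)
Lemma quad_form0 (S : 'M[R]_3) : S^T = S ->
  (forall x : 'cV[R]_3, x^T *m S *m x = 0) -> S = 0.
Proof.
move=> ST S0; apply/matrixP => i j; rewrite mxE.
pose e k : 'cV[R]_3 := delta_mx k 0.
have E k l : ((e k)^T *m S *m e l) 0 0 = S k l.
  by rewrite /e trmx_delta -rowE -colE !mxE.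
have Sii k : S k k = 0 by rewrite -E S0 mxE.
have := S0 (e i + e j).
have -> : (e i + e j)^T = (e i)^T + (e j)^T by rewrite linearD.
rewrite mulmxDl mulmxDl !mulmxDr !S0 add0r addr0.
move=> /matrixP /(_ 0 0); rewrite [LHS]mxE !E [RHS]mxE.
have -> : S j i = S i j by rewrite -{1}ST mxE.
by move=> H; lra.
Qed.

Lemma trmxB m n (A B : 'M[R]_(m, n)) : (A - B)^T = A^T - B^T.
Proof. exact: linearB. Qed.

Lemma mx11_eq (M : 'M[R]_1) : M = (\tr M)%:M.
Proof. by rewrite [LHS]mx11_scalar trace_mx11. Qed.

Lemma dotE (u v : 'cV[R]_3) : u^T *m v = (edot u v)%:M.
Proof. by rewrite edotE -mx11_eq. Qed.

(** The plane on which B is isometric is the orthogonal of a unit vector w, and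
    |B x|^2 is the square norm of the projection of x to it. *)
Lemma best_rank2P B : best_rank2 B <->
  exists2 w : 'cV[R]_3, edot w w = 1 & B^T *m B = 1%:M - w *m w^T.
Proof.
split=> [[U [dU isoU kerU]]|[w w1 BB]]; last first.
  have quad u : edot (B *m u) (B *m u) = edot u u - edot w u ^+ 2.
    rewrite [LHS]edotE trmx_mul -mulmxA (mulmxA B^T) BB mulmxBl mul1mx mulmxBr.
    rewrite linearB /= -edotE; congr (_ - _).
    rewrite -(mulmxA w) !dotE mul_mx_scalar edotZr (edotC u).
    by rewrite mxtrace_scalar expr2.
  exists (perp w); split; first by rewrite dim_perp // w1 oner_neq0.
    move=> u; rewrite mem_perp => /eqP uw.
    by rewrite !enormE quad uw expr0n subr0.
  move=> x xperp.
  have u0 : x - edot w x *: w = 0.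
    have uw : edot w (x - edot w x *: w) = 0.
      by rewrite -scaleNr edotDr edotZr w1 mulr1 subrr.
    apply: edot_eq0; rewrite -{2}scaleNr edotDr edotZr.
    by rewrite (edotC _ w) uw mulr0 addr0 xperp // mem_perp uw.
  rewrite -[x](subrK (edot w x *: w)) u0 add0r -scalemxAr.
  have -> : B *m w = 0 by apply: edot_eq0; rewrite quad w1 expr1n subrr.
  by rewrite scaler0.
(* a vector of the left kernel of the matrix whose columns are a basis of U *)
have [w0 w0nz w0U] : exists2 w : 'cV[R]_3, w != 0 & forall u, u \in U -> edot w u = 0.
  pose M : 'M[R]_(3, 2) := \matrix_(i, j) (vbasis U)`_j i 0.
  have kM : kermx M != 0.
    rewrite -mxrank_eq0 mxrank_ker -lt0n subn_gt0.
    exact: leq_ltn_trans (rank_leq_col M) _.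
  exists (nz_row (kermx M))^T.
    by rewrite -[0]trmx0 (inj_eq trmx_inj) nz_row_eq0.
  have /sub_kermxP HM := nz_row_sub (kermx M).
  move=> u uU; rewrite (coord_vbasis uU).
  rewrite (big_morph (edot _) (edotDr _) (_ : edot _ 0 = 0)); last first.
    by rewrite -(scale0r 0) edotZr mul0r.
  rewrite big1 // => i _; rewrite edotZr.
  have i2 : (i < 2)%N by apply: leq_trans (ltn_ord i) _; rewrite dU.
  have := congr1 (fun N : 'rV[R]_2 => N 0 (Ordinal i2)) HM.
  rewrite !mxE sum3 !mxE /= => H.
  suff -> : edot (nz_row (kermx M))^T (vbasis U)`_i = 0 by rewrite mulr0.
  by rewrite /edot sum3 !big_ord1 !mxE.
have w0pos : 0 < edot w0 w0.
  rewrite lt0r edot_ge0 andbT; apply: contraNneq w0nz => /edot_eq0 ->.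
  exact: eqxx.
pose w := (Num.sqrt (edot w0 w0))^-1 *: w0.
have w1 : edot w w = 1.
  rewrite edotZl edotZr mulrA -invfM -expr2 sqr_sqrtr ?ltW// mulVf //.
  by rewrite gt_eqF.
have wU u : u \in U -> edot w u = 0 by move=> /w0U; rewrite edotZl => ->; rewrite mulr0.
clearbody w.
have UE : U = perp w.
  apply/eqP; rewrite eqEdim dim_perp ?w1 ?oner_neq0// dU leqnn andbT.
  by apply/subvP => u /wU uw; rewrite mem_perp uw.
have Bw : B *m w = 0 by apply: kerU => u /wU; rewrite edotC.
exists w => //; apply/subr0_eq/quad_form0.
  by rewrite 2!trmxB !trmx_mul !trmxK trmx1.
move=> x; have uU : x - edot w x *: w \in U.
  by rewrite UE mem_perp -scaleNr edotDr edotZr w1 mulr1 subrr.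
have := isoU _ uU; rewrite mulmxBr -scalemxAr Bw scaler0 subr0 => E.
have {}E : edot (B *m x) (B *m x) = edot x x - edot w x ^+ 2.
  rewrite -enorm_sqr E enorm_sqr -scaleNr edotDr !edotDl !edotZr !edotZl w1.
  by rewrite (edotC x w); ring.
have BBx : x^T *m (B^T *m B) *m x = (edot (B *m x) (B *m x))%:M.
  by rewrite -dotE trmx_mul !mulmxA.
have wwx : x^T *m (w *m w^T) *m x = (edot w x ^+ 2)%:M.
  by rewrite mulmxA -mulmxA !dotE mul_scalar_mx scale_scalar_mx (edotC x) expr2.
rewrite mulmxBr mulmxBl mulmxBr mulmxBl mulmx1 BBx wwx E dotE.
by apply/matrixP => i j; rewrite !mxE !ord1 /=; ring.
Qed.

(** The radius that brings a best matrix, of norm the square root of 2, to the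
    sphere. *)
Definition best_scale : R := Num.sqrt (3 / 2).

Lemma best_scale_gt0 : 0 < best_scale.
Proof. by rewrite sqrtr_gt0 divr_gt0. Qed.

Lemma best_scale_sqr : best_scale ^+ 2 = 3 / 2.
Proof. by rewrite sqr_sqrtr // divr_ge0. Qed.

(** A symmetric matrix of the plane of the first two coordinates, split into its
    conformal part p and its traceless part (a, b). *)
Definition planar (p a b : R) : 'M[R]_3 := mx3 (p + a) b 0 b (p - a) 0 0 0 0.

Definition plane_proj := planar 1 0 0.

Lemma plane_projE : plane_proj = 1%:M - axis3 *m axis3^T.
Proof.
by rewrite /axis3 trmx_delta mul_delta_mx; apply: mx3P;
  rewrite !mxE /= ?(subr0, addr0, subrr).
Qed.

(** An orthonormal basis adapted to the plane is sent by the best matrix to two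
    orthonormal vectors, which are completed by their cross product. *)
Lemma M5_frame P : M5 P <->
  exists U V, [/\ orth U, orth V & P = U *m planar best_scale 0 0 *m V^T].
Proof.
have P0E : planar best_scale 0 0 = best_scale *: plane_proj.
  by rewrite /plane_proj /planar mx3Z; congr mx3; rewrite ?(addr0, subr0, mulr1, mulr0).
split=> [[B /best_rank2P[w w1 BB] ->]|[U [V [oU oV ->]]]]; last first.
  exists (U *m plane_proj *m V^T); last by rewrite P0E -scalemxAr -scalemxAl.
  apply/best_rank2P; exists (V *m axis3).
    rewrite edotE trmx_mul -mulmxA (mulmxA V^T) oV mul1mx.
    by rewrite /axis3 trmx_delta mul_delta_mx /mxtrace big_ord1 mxE !eqxx.
  rewrite trmx_mul trmx_mul trmxK -!mulmxA (mulmxA U^T) oU mul1mx !mulmxA.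
  have EE : plane_proj^T *m plane_proj = plane_proj.
    by rewrite /plane_proj /planar mx3T mx3M; congr mx3; ring.
  rewrite -(mulmxA V) EE plane_projE mulmxBr mulmxBl mulmx1 orthC // trmx_mul.
  by rewrite !mulmxA.
have [V oV Vw] : exists2 V, orth V & V *m axis3 = w.
  by apply: orth_completion; rewrite dotE w1.
have CC : (B *m V)^T *m (B *m V) = plane_proj.
  rewrite trmx_mul -!mulmxA (mulmxA B^T) BB mulmxBl mul1mx mulmxBr oV.
  by rewrite plane_projE -Vw trmx_mul -!mulmxA oV mulmx1 (mulmxA V^T) oV mul1mx.
suff [U oU UE] : exists2 U, orth U & B *m V = U *m plane_proj.
  exists U, V; split=> //.
  by rewrite P0E -scalemxAr -scalemxAl -UE -mulmxA orthC // mulmx1.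
move: CC; move: (B *m V) => C; rewrite (mx3E C).
move: (C 0 0) (C 0 1) (C 0 2) (C 1 0) (C 1 1) (C 1 2) (C 2 0) (C 2 1) (C 2 2).
move=> a b c d e f g h i; rewrite mx3T mx3M => CE.
have /matrixP CE' := CE.
have := CE' 0 0; have := CE' 0 1; have := CE' 1 1; have := CE' 2 2.
rewrite !mxE /= => H22 H11 H01 H00.
have [c0 f0 i0] : [/\ c = 0, f = 0 & i = 0] by split; nra.
(* the third column is the cross product of the first two *)
exists (mx3 a b (d * h - e * g) d e (b * g - a * h) g h (a * e - b * d)).
  rewrite /orth mx3T mx3M mx3_1; congr mx3; lra || nra.
by rewrite /plane_proj /planar mx3M c0 f0 i0; congr mx3; ring.
Qed.

End BestMatrices.

(** * Matrices of rank 2 *)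

Section RankTwo.
Context {R : realType}.
Implicit Types (p a b : R) (A B U V P : 'M[R]_3).

Lemma sqrD_eq0 a b : a ^+ 2 + b ^+ 2 = 0 -> a = 0 /\ b = 0.
Proof.
move=> /eqP; rewrite paddr_eq0 ?sqr_ge0// !sqrf_eq0.
by move=> /andP[/eqP-> /eqP->].
Qed.

(** Twice the sum of the squares of the minors of size 2, by the Lagrange
    identity; it vanishes on matrices of rank at most 1. *)
Definition minors_sqr A : R := edot A A ^+ 2 - edot (A^T *m A) (A^T *m A).

Lemma minors_sqr_orth U V A : orth U -> orth V ->
  minors_sqr (U *m A *m V^T) = minors_sqr A.
Proof.
move=> oU oV; rewrite /minors_sqr edot_orth //; congr (_ - _).
rewrite !trmx_mul trmxK -!mulmxA (mulmxA U^T) oU mul1mx.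
by rewrite (mulmxA A^T) (mulmxA V) edot_orth.
Qed.

Lemma minors_sqr_planar p a b :
  minors_sqr (planar p a b) = 2 * (p ^+ 2 - a ^+ 2 - b ^+ 2) ^+ 2.
Proof. by rewrite /minors_sqr /planar mx3T mx3M !edot_mx3; ring. Qed.

Lemma edot_planar p a b p' a' b' :
  edot (planar p a b) (planar p' a' b') = 2 * (p * p' + a * a' + b * b').
Proof. by rewrite edot_mx3; ring. Qed.

Lemma det_planar p a b : \det (planar p a b) = 0.
Proof. by rewrite det_mx3; ring. Qed.

Lemma minors_sqr_rank1 A : \rank A = 1%N -> minors_sqr A = 0.
Proof.
move=> rA; have [C [D ->]] : exists (C : 'cV[R]_3) (D : 'rV[R]_3), A = C *m D.
  move: (mulmx_base A); move: (col_base A) (row_base A); rewrite rA => C D <-.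
  by exists C, D.
rewrite (mx3E (C *m D)) !mxE !big_ord1 /minors_sqr mx3T mx3M !edot_mx3; ring.
Qed.

Lemma S8P A : @S8 R A <-> edot A A = 3.
Proof. exact: enormP. Qed.

Lemma V7_orth U V A : orth U -> orth V -> V7 A -> V7 (U *m A *m V^T).
Proof.
move=> oU oV [/S8P SA dA]; split; first by apply/S8P; rewrite edot_orth.
by rewrite !det_mulmx dA mulr0 mul0r.
Qed.

Lemma V7_planar p a b : 2 * (p ^+ 2 + a ^+ 2 + b ^+ 2) = 3 -> V7 (planar p a b).
Proof.
move=> E; split; last exact: det_planar.
by apply/S8P; rewrite edot_planar -E -!expr2.
Qed.

Lemma unit_kernel A : \det A = 0 ->
  exists2 w : 'cV[R]_3, w^T *m w = 1%:M & w^T *m A = 0.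
Proof.
move=> /eqP/det0P[v v0 vA]; pose k := Num.sqrt (edot v^T v^T).
have k0 : k != 0.
  rewrite gt_eqF // sqrtr_gt0 lt0r edot_ge0 andbT.
  apply: contraNneq v0 => /edot_eq0/(congr1 trmx); rewrite trmxK => ->.
  by rewrite trmx0.
exists (k^-1 *: v^T); last by rewrite linearZ /= trmxK -scalemxAl vA scaler0.
rewrite dotE edotZl edotZr mulrA -invfM -expr2 sqr_sqrtr ?edot_ge0//.
rewrite mulVf //; apply: contraNneq k0 => k0; apply/eqP.
by rewrite /k k0 sqrtr0.
Qed.

(** Unit vectors of the left and right kernels, completed to orthonormal bases,
    bring A to a matrix of the plane. Its determinant ad - bc is not 0 because the
    rank is not 1; a reflection makes it positive, and the rotation of the polar
    decomposition makes the matrix symmetric, with trace 2 p > 0. *)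
Lemma planar_form A : edot A A = 3 -> \det A = 0 -> \rank A != 1%N ->
  exists U V, [/\ orth U, orth V & exists p a b,
    [/\ A = U *m planar p a b *m V^T, 0 < p & a ^+ 2 + b ^+ 2 < p ^+ 2]].
Proof.
move=> A3 dA rA.
have [u u1 uA] := unit_kernel dA; have [U1 oU1 U1u] := orth_completion u1.
have [v v1 vA] : exists2 v : 'cV[R]_3, v^T *m v = 1%:M & v^T *m A^T = 0.
  by apply: unit_kernel; rewrite det_tr.
have [V oV Vv] := orth_completion v1.
pose Y := U1^T *m A *m V.
have Y3r j : Y 2 j = 0.
  have : axis3^T *m Y = 0.
    by rewrite /Y !mulmxA -trmx_mul U1u uA mul0mx.
  by rewrite /axis3 trmx_delta -rowE => /matrixP /(_ 0 j); rewrite !mxE.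
have Y3c i : Y i 2 = 0.
  have : Y *m axis3 = 0.
    rewrite /Y -mulmxA Vv -mulmxA; apply: (can_inj (@trmxK _ _ _)).
    by rewrite !trmx_mul vA mul0mx trmx0.
  by rewrite /axis3 -colE => /matrixP /(_ i 0); rewrite !mxE.
have AY : A = U1 *m Y *m V^T by rewrite /Y orth_frameKV.
have rY : \rank Y != 1%N.
  suff -> : \rank Y = \rank A by [].
  rewrite AY; apply: esym.
  have unit_orth W : orth W -> W \in unitmx by move=> /mulmx1_unit[].
  rewrite mxrankMfree ?row_free_unit ?unit_orth//; last exact: orth_tr.
  by rewrite (eqmxMfull _ _) // row_full_unit unit_orth.
have Y3 : edot Y Y = 3 by rewrite -A3 AY edot_orth.
move: Y Y3r Y3c AY rY Y3 => Y Y3r Y3c AY rY Y3.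
have YE := mx3E Y; rewrite !Y3r !Y3c in YE.
move: (Y 0 0) (Y 0 1) (Y 1 0) (Y 1 1) YE => a b c d YE.
(* otherwise the two nonzero rows are proportional and the rank is 1 *)
have e0 : a * d - b * c != 0.
  apply: contraNneq rY => e0.
  have Y0 : Y != 0.
    apply/eqP => Y0; move: Y3; rewrite Y0 mx3_0 edot_mx3; lra.
  have : (0 < \rank Y)%N by rewrite lt0n mxrank_eq0.
  suff [C [D ->]] : exists (C : 'cV[R]_3) (D : 'rV[R]_3), Y = C *m D.
    by move=> r0; rewrite eqn_leq r0 andbT mulmx_max_rank.
  have outer (C : 'cV[R]_3) (D : 'rV[R]_3) : C *m D = 
      mx3 (C 0 0 * D 0 0) (C 0 0 * D 0 1) (C 0 0 * D 0 2)
          (C 1 0 * D 0 0) (C 1 0 * D 0 1) (C 1 0 * D 0 2)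
          (C 2 0 * D 0 0) (C 2 0 * D 0 1) (C 2 0 * D 0 2).
    by rewrite [LHS]mx3E !mxE !big_ord1.
  pose col x y z : 'cV[R]_3 := \col_i nth 0 [:: x; y; z] i.
  pose row x y z : 'rV[R]_3 := \row_i nth 0 [:: x; y; z] i.
  have [a0|a0] := eqVneq a 0; last first.
    have E : d = c / a * b by rewrite mulrAC; apply: (canRL (mulfK a0)); lra.
    exists (col 1 (c / a) 0), (row a b 0); rewrite YE outer !mxE /=.
    by congr mx3; rewrite ?(mul1r, mulr0, mul0r) ?divfK.
  have [b0|b0] := eqVneq b 0; last first.
    have E : c = d / b * a by rewrite mulrAC; apply: (canRL (mulfK b0)); lra.
    exists (col 1 (d / b) 0), (row a b 0); rewrite YE outer !mxE /=.
    by congr mx3; rewrite ?(mul1r, mulr0, mul0r) ?divfK.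
  exists (col 0 1 0), (row c d 0); rewrite YE outer !mxE /=.
  by congr mx3; rewrite ?a0 ?b0 ?(mul1r, mulr0, mul0r).
(* change the sign of the second row if the determinant is negative *)
have {U1 oU1 U1u AY YE Y3 Y3r Y3c rY e0} [U1 oU1 [a' [b' [c' [d' [AY e0]]]]]] :
    exists2 U1, orth U1 & exists a b c d, A = U1 *m mx3 a b 0 c d 0 0 0 0 *m V^T /\
      0 < a * d - b * c.
  have [epos|eneg|e0'] := ltgtP 0 (a * d - b * c); last by rewrite -e0' eqxx in e0.
    by exists U1 => //; exists a, b, c, d; rewrite -YE.
  exists (U1 *m mx3 1 0 0 0 (-1) 0 0 0 1).
    by apply: orthM => //; rewrite /orth mx3T mx3M mx3_1; congr mx3; ring.
  exists a, b, (- c), (- d); split; last by lra.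
  rewrite AY YE -[in RHS](mulmxA U1); congr (_ *m _ *m _).
  by rewrite mx3M; congr mx3; ring.
move: a b c d => _ _ _ _; move: a' b' c' d' AY e0 => a b c d AY e0.
(* the rotation with rows (x, y) and (-y, x) is the conformal part of the matrix,
   divided by its norm m *)
pose m2 := (a + d) ^+ 2 + (b - c) ^+ 2.
have m2pos : 0 < m2 by rewrite /m2; nra.
pose m := Num.sqrt m2; have mpos : 0 < m by rewrite sqrtr_gt0.
have mm : m * m = m2 by rewrite -expr2 sqr_sqrtr // ltW.
have m0 : m != 0 by rewrite gt_eqF.
pose x := (a + d) / m; pose y := (b - c) / m.
have xm : x * m = a + d by rewrite divfK.
have ym : y * m = b - c by rewrite divfK.
have xy1 : x * x + y * y = 1.
  apply: (mulIf (lt0r_neq0 m2pos)); rewrite -{1}mm mul1r.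
  have -> : (x * x + y * y) * (m * m) = (x * m) ^+ 2 + (y * m) ^+ 2 by ring.
  by rewrite xm ym.
exists (U1 *m mx3 x y 0 (- y) x 0 0 0 1), V; split=> //.
  by apply: orthM => //; rewrite /orth mx3T mx3M mx3_1; congr mx3; lra.
have s1 : x * a - y * c + (y * b + x * d) = m.
  have -> : x * a - y * c + (y * b + x * d) = x * (a + d) + y * (b - c) by ring.
  by rewrite -xm -ym -[RHS]mul1r -xy1; ring.
have s2 : y * a + x * c = x * b - y * d.
  have : x * (y * m) = y * (x * m) by ring.
  by rewrite xm ym => H; lra.
pose a' := (x * a - y * c - (y * b + x * d)) / 2.
have pa : m / 2 + a' = x * a - y * c by rewrite /a' -s1; field.
have pd : m / 2 - a' = y * b + x * d by rewrite /a' -s1; field.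
exists (m / 2), a', (x * b - y * d); split; last 2 first.
- by rewrite divr_gt0.
- rewrite -subr_gt0.
  have -> : (m / 2) ^+ 2 - (a' ^+ 2 + (x * b - y * d) ^+ 2) =
      (m / 2 + a') * (m / 2 - a') - (x * b - y * d) * (x * b - y * d) by ring.
  rewrite pa pd -{1}s2.
  have -> : (x * a - y * c) * (y * b + x * d) - (y * a + x * c) * (x * b - y * d)
    = (x * x + y * y) * (a * d - b * c) by ring.
  by rewrite xy1 mul1r.
have xy k : k = (x * x + y * y) * k by rewrite xy1 mul1r.
rewrite AY -[in RHS](mulmxA U1); congr (_ *m _ *m _).
rewrite /planar pa pd mx3M; congr mx3; try ring.
- by rewrite -s2 [LHS]xy; ring.
- by rewrite [LHS]xy; ring.
- by rewrite -s2 [LHS]xy; ring.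
- by rewrite [LHS]xy; ring.
Qed.

(** In particular the matrices of rank 2 are open in V^7. *)
Lemma rank2P A : (V7 `\` M4) A <-> V7 A /\ 0 < minors_sqr A.
Proof.
split=> [[VA nM]|[VA qA]]; split=> //; last first.
  by move=> [_ /minors_sqr_rank1 q0]; rewrite q0 ltxx in qA.
have [/S8P A3 dA] := VA.
have rA : \rank A != 1%N by apply/eqP => rA; apply: nM.
have [U [V [oU oV [p [a [b [-> p0 pab]]]]]]] := planar_form A3 dA rA.
rewrite minors_sqr_orth // minors_sqr_planar mulr_gt0 // exprn_gt0 //; lra.
Qed.

End RankTwo.

(** * Tangent spaces *)

Section TangentSpaces.
Context {R : realType}.
Implicit Types (A B U V P N v : 'M[R]_3) (X Y : set 'M[R]_3).

Lemma smooth_derivable (W : normedModType R) (I : set R^o) (g : R^o -> W) t :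
  smooth_on I g -> I t -> derivable g t 1.
Proof. by move=> /(_ 1%N)[dg _] /dg /derivable1_diffP. Qed.

Lemma is_derive_entry (I : set R^o) (g : R^o -> 'M[R]_3) t i j :
  smooth_on I g -> I t ->
  is_derive (t : R) (1 : R) (fun s => g s i j : R) ('D_1 g t i j).
Proof.
move=> sg It; have dg := smooth_derivable sg It.
split; first exact: ((derivable_mxP g t 1).1 dg i j).
by rewrite derive_mx // mxE.
Qed.

Definition frame_map U V A := U *m A *m V^T.

Lemma frame_map_linear U V : linear (frame_map U V).
Proof. by move=> k A B; rewrite /frame_map mulmxDr mulmxDl -scalemxAr -scalemxAl. Qed.

HB.instance Definition _ U V := GRing.isLinear.Build R 'M[R]_3 'M[R]_3 *:%R
  (frame_map U V) (frame_map_linear U V).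

Lemma frame_map_continuous U V : continuous (frame_map U V).
Proof.
have oT : open [set: 'M[R]_3] by exact: openT.
apply: smooth_on_continuous; apply: (smooth_mxM oT); last exact: smooth_on_cst.
by apply: (smooth_mxM oT); [exact: smooth_on_cst|exact: smooth_on_id].
Qed.

Lemma tangent_frame U V X Y P v : (forall A, X A -> Y (frame_map U V A)) ->
  tangent_space X P v -> tangent_space Y (frame_map U V P) (frame_map U V v).
Proof.
move=> XY [I [g [[oI I0 sg] [gX g0 gv]]]].
exists I, (frame_map U V \o g); split; split=> //.
- by move=> k; apply: Ck_on_comp_linear => //; exact: frame_map_continuous.
- by move=> t It; exact/XY/gX.
- by rewrite /= g0.
have [dg _] := sg 1%N.
have dL A : differentiable (frame_map U V) A.
  by apply: linear_differentiable; exact: frame_map_continuous.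
rewrite -gv !deriveE; [|exact: dg|by apply: differentiable_comp => //; exact: dg].
apply: etrans (congr1 (@^~ 1) (diff_comp (dg _ I0) (dL _))) _.
exact: (congr1 (@^~ ('d g 0 1)) (diff_lin _ (@frame_map_continuous U V))).
Qed.

(** Curves of this form include the great circles of the sphere and the orbits of
    a point of M^5 under one-parameter groups of rotations; the speed w allows
    all multiples of A1, including 0. *)
Lemma trig_curve_tangent X A0 A1 A2 (w : R) :
  (forall t, X (A0 + sin t *: A1 + cos t *: A2)) ->
  tangent_space X (A0 + A2) (w *: A1).
Proof.
move=> HX; pose g (t : R^o) := A0 + sin (w * t) *: A1 + cos (w * t) *: A2.
have oT : open [set: R^o] by exact: openT.
have sw : smooth_on [set: R^o] (fun t : R^o => w * t : R^o).
  by apply: smooth_cstM => //; exact: smooth_on_id.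
have [ss sc] := @smooth_on_sin_cos R setT.
have sg : smooth_on setT g.
  apply: (@smooth_onD _ _ _ _ (fun t => A0 + sin (w * t) *: A1)) => //.
    apply: smooth_onD => //; first exact: smooth_on_cst.
    by apply: smooth_on_scale => //; apply: (smooth_on_comp1 oT ss).
  by apply: smooth_on_scale => //; apply: (smooth_on_comp1 oT sc).
exists setT, g; split; split=> //.
- by move=> t _; exact: HX.
- by rewrite /g mulr0 sin0 cos0 scale0r scale1r addr0.
apply/matrixP => i j.
have [_ <-] := is_derive_entry i j sg (I : setT (0 : R^o)).
have dw : is_derive (0 : R) (1 : R) (fun t => w * t) w.
  by have := @is_deriveZ R R^o R^o id w 0 1 1 (is_derive_id _ _);
    rewrite /GRing.scale /= mulr1.
have ds := is_derive1_comp (@is_derive_sin R (w * 0)) dw.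
have dc := is_derive1_comp (@is_derive_cos R (w * 0)) dw.
have dd := is_deriveD (is_derive_cst (A0 i j) (0 : R) 1)
  (is_deriveD (is_deriveZ (A1 i j) ds) (is_deriveZ (A2 i j) dc)).
rewrite (_ : (fun s => g s i j) = (cst (A0 i j) +
    (A1 i j *: (sin \o *%R w) + A2 i j *: (cos \o *%R w)))).
  have [_ ->] := dd; rewrite !mxE mulr0 sin0 cos0 oppr0 !mul0r /GRing.scale /=; ring.
by apply/funext => s; rewrite /g !mxE !fctE /GRing.scale /=; ring.
Qed.

(** Entrywise derivatives, for which the product rule of matrices is a sum of
    scalar product rules. *)
Definition is_velocity (g : R -> 'M[R]_3) t v :=
  forall i j, is_derive t (1 : R) (fun s => g s i j) (v i j).

Lemma is_velocity_curve (I : set R^o) (g : R^o -> 'M[R]_3) t :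
  smooth_on I g -> I t -> is_velocity g t ('D_1 g t).
Proof. by move=> sg It i j; exact: is_derive_entry sg It. Qed.

Lemma is_velocityM g h t v w : is_velocity g t v -> is_velocity h t w ->
  is_velocity (fun s => g s *m h s) t (v *m h t + g t *m w).
Proof.
move=> dg dh i j.
have D k := is_deriveM (dg i k) (dh k j).
have DD := is_deriveD (is_deriveD (D 0) (D 1)) (D 2).
rewrite (_ : (fun s => _) = (fun s => g s i 0) * (fun s => h s 0 j) +
  (fun s => g s i 1) * (fun s => h s 1 j) + (fun s => g s i 2) * (fun s => h s 2 j)).
  apply: is_derive_eq DD _; rewrite !mxE !sum3 /GRing.scale /=; ring.
by apply/funext => s; rewrite !mxE sum3.
Qed.

Lemma is_velocityT g t v : is_velocity g t v ->
  is_velocity (fun s => (g s)^T) t v^T.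
Proof.
move=> dg i j; rewrite mxE (_ : (fun s => _) = (fun s => g s j i)); first exact: dg.
by apply/funext => s; rewrite mxE.
Qed.

Lemma is_velocity_unique (I : set R^o) g h t v w : open I -> I t ->
  (forall s, I s -> g s = h s) -> is_velocity g t v -> is_velocity h t w ->
  v = w.
Proof.
move=> oI It gh dg dh; apply/matrixP => i j.
have [_ <-] := dg i j; have [_ <-] := dh i j; apply: near_eq_derive.
by apply: filterS (open_nbhs_nbhs (conj oI It)) => s /gh ->.
Qed.

(** The equation that defines M^5 up to the rank; its derivative cuts out the
    tangent space. *)
Lemma M5_cubic A : M5 A -> A *m A^T *m A = (3 / 2) *: A.
Proof.
move=> /M5_frame[U [V [oU oV ->]]].
rewrite frame_cube // scalemxAl scalemxAr; congr (_ *m _ *m _).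
rewrite -best_scale_sqr /planar mx3T !mx3M mx3Z; congr mx3; ring.
Qed.

(** With E the projection to the plane, the derivative of the cubic equation is
    v E + E v^T E + E v = v, so the planar block of v is skew-symmetric. *)
Lemma M5_tangent v : tangent_space M5 (planar best_scale 0 0) v ->
  [/\ v 0 0 = 0, v 1 1 = 0 & v 0 1 + v 1 0 = 0].
Proof.
move=> [I [g [[oI I0 sg] [gM g0 gv]]]].
have dg : is_velocity g 0 v by rewrite -gv; exact: is_velocity_curve sg I0.
have dgg := is_velocityM (is_velocityM dg (is_velocityT dg)) dg.
have d32 : is_velocity (fun s => (3 / 2)%:M *m g s) 0 ((3 / 2)%:M *m v).
  move=> i j; rewrite !mul_scalar_mx.
  apply: is_derive_eq; last by rewrite mxE; exact: erefl.
  rewrite (_ : (fun s => _) = (3 / 2) *: (fun s => g s i j)).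
    exact: is_deriveZ.
  by apply/funext => s; rewrite mul_scalar_mx mxE.
have gE s : I s -> g s *m (g s)^T *m g s = (3 / 2)%:M *m g s.
  by move=> Is; rewrite mul_scalar_mx; exact/M5_cubic/gM.
have := is_velocity_unique oI I0 gE dgg d32.
rewrite g0 mul_scalar_mx (mx3E v) -best_scale_sqr /planar mx3T !(mx3D, mx3M, mx3T) mx3Z.
have c0 : best_scale ^+ 2 != 0 :> R by rewrite sqrf_eq0 gt_eqF // best_scale_gt0.
move=> /matrixP E.
have := E 0 0; have := E 0 1; have := E 1 0; have := E 1 1.
rewrite !mxE /=.
move: (v 0 0) (v 0 1) (v 1 0) (v 1 1) => v00 v01 v10 v11 E11 E10 E01 E00.
by split; apply: (mulfI c0); clear -E11 E10 E01 E00; lra.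
Qed.

(** The derivatives at the base point of the determinant and of the square
    norm. *)
Lemma V7_tangent v : tangent_space V7 (planar best_scale 0 0) v ->
  v 2 2 = 0 /\ v 0 0 + v 1 1 = 0.
Proof.
move=> [I [g [[oI I0 sg] [gV g0 gv]]]].
have dg : is_velocity g 0 v by rewrite -gv; exact: is_velocity_curve sg I0.
have c0 : best_scale != 0 :> R by rewrite gt_eqF // best_scale_gt0.
have nI : \forall s \near (0 : R^o), I s by exact: open_nbhs_nbhs (conj oI I0).
split.
  pose G i j s := g s i j.
  have DG i j : is_derive (0 : R) (1 : R) (G i j) (v i j) by exact: dg.
  have d3 i j k l m n : is_derive (0 : R) (1 : R) (G i j * (G k l * G m n))
      (G i j 0 * (G k l 0 * v m n + G m n 0 * v k l) + G k l 0 * G m n 0 * v i j).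
    exact: is_deriveM (DG i j) (is_deriveM (DG k l) (DG m n)).
  have D := is_deriveB
    (is_deriveD (is_deriveD (d3 0 0 1 1 2 2) (d3 0 1 1 2 2 0))
      (d3 0 2 1 0 2 1))
    (is_deriveD (is_deriveD (d3 0 0 1 2 2 1) (d3 0 1 1 0 2 2))
      (d3 0 2 1 1 2 0)).
  have {D}[_ D] := D; move: D.
  rewrite (near_eq_derive (g := cst 0)); last first.
    apply: filterS nI => s /gV[_]; rewrite (mx3E (g s)) det_mx3 => <-.
    by rewrite /G !fctE; ring.
  rewrite derive_cst /G g0 /planar !mxE /GRing.scale /= => D.
  by apply: (mulfI (mulf_neq0 c0 c0)); lra.
have dgg := is_velocityM (is_velocityT dg) dg.
have D := is_deriveD (is_deriveD (dgg 0 0) (dgg 1 1)) (dgg 2 2).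
have {D}[_ D] := D; move: D.
rewrite (near_eq_derive (g := cst (3 : R^o))); last first.
  apply: filterS nI => s /gV[/S8P + _]; rewrite edotE => <-.
  by rewrite /mxtrace sum3.
rewrite derive_cst g0 (mx3E v) /planar !(mx3D, mx3M, mx3T) !mxE /=.
by move=> D; apply: (mulfI c0); lra.
Qed.

End TangentSpaces.

(** * Normal vectors *)

Section NormalVectors.
Context {R : realType}.
Implicit Types (A B U V P N v : 'M[R]_3) (X Y : set 'M[R]_3) (a b p : R).

Notation P0 := (planar best_scale 0 0 : 'M[R]_3).

Lemma rotation_curve_tangent A0 A1 A2 : P0 = A0 + A2 ->
  (forall t, exists U V,
    [/\ orth U, orth V & A0 + sin t *: A1 + cos t *: A2 = U *m P0 *m V^T]) ->
  tangent_space M5 P0 A1.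
Proof.
move=> P0E H; rewrite P0E -[A1]scale1r; apply: trig_curve_tangent => t.
by apply/M5_frame; exact: H.
Qed.

Lemma cos2sin2 (t : R) : cos t * cos t + sin t * sin t = 1.
Proof. by rewrite -!expr2 cos2Dsin2. Qed.

(** A normal vector is orthogonal to the velocities of the rotations of the
    coordinate planes acting on the left and on the right, which kills all entries
    outside the planar block and makes this block symmetric; [V7_tangent] makes it
    traceless. Conversely such a matrix is the velocity of a great circle of V^7,
    and it is orthogonal to the skew-symmetric blocks of [M5_tangent]. *)
Lemma normal_planar N :
  normal_vectors V7 M5 P0 N <-> exists a b, N = planar 0 a b.
Proof.
have c0 := @best_scale_gt0 R; have cN0 : best_scale != 0 :> R by rewrite gt_eqF.
split=> [[/V7_tangent[N22 N11]] NM|[a [b ->]]].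
  have H a b c d e f g h i : tangent_space M5 P0 (mx3 a b c d e f g h i) ->
      N 0 0 * a + N 0 1 * b + N 0 2 * c + (N 1 0 * d + N 1 1 * e + N 1 2 * f)
      + (N 2 0 * g + N 2 1 * h + N 2 2 * i) = 0.
    by move=> /NM; rewrite {1}(mx3E N) edot_mx3.
  (* the rotation of the plane itself *)
  have t1 : tangent_space M5 P0 (mx3 0 best_scale 0 (- best_scale) 0 0 0 0 0).
    apply: (@rotation_curve_tangent 0 _ P0) => [|t]; first by rewrite add0r.
    exists (mx3 (cos t) (sin t) 0 (- sin t) (cos t) 0 0 0 1), 1%:M.
    have cs := cos2sin2 t; split; [|exact: orth1|].
      by rewrite /orth mx3T mx3M mx3_1; congr mx3; lra.
    by rewrite trmx1 mulmx1 add0r /planar !mx3Z mx3M mx3D; congr mx3; ring.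
  (* the rotations that mix the third coordinate with the first and the second *)
  pose G1 (t : R) := mx3 (cos t) 0 (- sin t) 0 1 0 (sin t) 0 (cos t).
  pose G2 (t : R) := mx3 1 0 0 0 (cos t) (- sin t) 0 (sin t) (cos t).
  have r1 t : orth (G1 t).
    by have cs := cos2sin2 t; rewrite /orth mx3T mx3M mx3_1; congr mx3; lra.
  have r2 t : orth (G2 t).
    by have cs := cos2sin2 t; rewrite /orth mx3T mx3M mx3_1; congr mx3; lra.
  have t2 : tangent_space M5 P0 (mx3 0 0 0 0 0 0 best_scale 0 0).
    apply: (@rotation_curve_tangent (mx3 0 0 0 0 best_scale 0 0 0 0) _
      (mx3 best_scale 0 0 0 0 0 0 0 0)).
      by rewrite /planar mx3D; congr mx3; ring.
    move=> t; exists (G1 t), 1%:M; split; [exact: r1|exact: orth1|].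
    by rewrite trmx1 mulmx1 /planar !mx3Z mx3M !mx3D; congr mx3; ring.
  have t3 : tangent_space M5 P0 (mx3 0 0 best_scale 0 0 0 0 0 0).
    apply: (@rotation_curve_tangent (mx3 0 0 0 0 best_scale 0 0 0 0) _
      (mx3 best_scale 0 0 0 0 0 0 0 0)).
      by rewrite /planar mx3D; congr mx3; ring.
    move=> t; exists 1%:M, (G1 t); split; [exact: orth1|exact: r1|].
    by rewrite mul1mx /planar mx3T !mx3Z mx3M !mx3D; congr mx3; ring.
  have t4 : tangent_space M5 P0 (mx3 0 0 0 0 0 0 0 best_scale 0).
    apply: (@rotation_curve_tangent (mx3 best_scale 0 0 0 0 0 0 0 0) _
      (mx3 0 0 0 0 best_scale 0 0 0 0)).
      by rewrite /planar mx3D; congr mx3; ring.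
    move=> t; exists (G2 t), 1%:M; split; [exact: r2|exact: orth1|].
    by rewrite trmx1 mulmx1 /planar !mx3Z mx3M !mx3D; congr mx3; ring.
  have t5 : tangent_space M5 P0 (mx3 0 0 0 0 0 best_scale 0 0 0).
    apply: (@rotation_curve_tangent (mx3 best_scale 0 0 0 0 0 0 0 0) _
      (mx3 0 0 0 0 best_scale 0 0 0 0)).
      by rewrite /planar mx3D; congr mx3; ring.
    move=> t; exists 1%:M, (G2 t); split; [exact: orth1|exact: r2|].
    by rewrite mul1mx /planar mx3T !mx3Z mx3M !mx3D; congr mx3; ring.
  exists (N 0 0), (N 0 1).
  have z (x : R) : x * best_scale = 0 -> x = 0.
    by move=> /eqP; rewrite mulf_eq0 (negbTE cN0) orbF => /eqP.
  have := H _ _ _ _ _ _ _ _ _ t1; have := H _ _ _ _ _ _ _ _ _ t2.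
  have := H _ _ _ _ _ _ _ _ _ t3; have := H _ _ _ _ _ _ _ _ _ t4.
  have := H _ _ _ _ _ _ _ _ _ t5; clear -N22 N11 z.
  rewrite !mulr0 mulrN !add0r !addr0 => /z N12 /z N21 /z N02 /z N20 N01.
  have {}N01 : N 0 1 - N 1 0 = 0 by apply: z; rewrite mulrBl.
  by rewrite [LHS]mx3E /planar N12 N21 N02 N20 N22; congr mx3; lra.
split.
  (* w is the angular length of N, and (a', b') its direction on the sphere *)
  have [w [a' [b' [-> -> ab]]]] : exists w a' b', [/\ a = w * a', b = w * b' &
      2 * (a' ^+ 2 + b' ^+ 2) = 3].
    have [ab0|ab0] := eqVneq (a ^+ 2 + b ^+ 2) 0.
      have [-> ->] := sqrD_eq0 ab0.
      exists 0, best_scale, 0; rewrite !mul0r best_scale_sqr; by split=> //; lra.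
    pose w : R := Num.sqrt (2 * (a ^+ 2 + b ^+ 2) / 3).
    have s0 : 0 < a ^+ 2 + b ^+ 2.
      by rewrite lt0r ab0 /=; apply: addr_ge0; exact: sqr_ge0.
    have w2 : w ^+ 2 = 2 * (a ^+ 2 + b ^+ 2) / 3.
      by rewrite sqr_sqrtr // divr_ge0 // mulr_ge0 // ltW.
    have w0 : w != 0 by rewrite -sqrf_eq0 w2 !mulf_neq0 ?invr_eq0.
    exists w, (a / w), (b / w); rewrite ![w * _]mulrC !divfK //; split=> //.
    by rewrite !exprMn exprVn w2; field.
  have -> : planar 0 (w * a') (w * b') = w *: planar 0 a' b'.
    by rewrite /planar mx3Z; congr mx3; ring.
  rewrite -[P0]add0r; apply: trig_curve_tangent => t.
  have -> : 0 + sin t *: planar 0 a' b' + cos t *: P0 =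
      planar (cos t * best_scale) (sin t * a') (sin t * b').
    by rewrite add0r /planar !mx3Z !mx3D; congr mx3; ring.
  apply: V7_planar; rewrite !exprMn best_scale_sqr -addrA -mulrDr.
  have -> : a' ^+ 2 + b' ^+ 2 = 3 / 2 by lra.
  by rewrite -mulrDl cos2Dsin2; field.
move=> v /M5_tangent[v00 v11 v01].
rewrite (mx3E v) edot_mx3 v00 v11.
have -> : v 1 0 = - v 0 1 by lra.
by ring.
Qed.

Lemma M5_frame_map U V A : orth U -> orth V -> M5 A -> M5 (frame_map U V A).
Proof.
move=> oU oV /M5_frame[U' [V' [oU' oV' ->]]]; apply/M5_frame.
exists (U *m U'), (V *m V'); split; try exact: orthM.
by rewrite /frame_map trmx_mul !mulmxA.
Qed.

Lemma frame_mapK U V A : orth U -> orth V ->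
  frame_map U^T V^T (frame_map U V A) = A.
Proof. by move=> oU oV; rewrite /frame_map trmxK orth_frameK. Qed.

Lemma normal_vectors_frame U V P N : orth U -> orth V ->
  normal_vectors V7 M5 P N ->
  normal_vectors V7 M5 (frame_map U V P) (frame_map U V N).
Proof.
move=> oU oV [tN nN]; split.
  by apply: (tangent_frame _ tN) => A; exact: V7_orth.
move=> v tv; have /nN : tangent_space M5 P (frame_map U^T V^T v).
  rewrite -[P](frame_mapK P oU oV).
  by apply: (tangent_frame _ tv) => A; apply: M5_frame_map; exact: orth_tr.
rewrite -(edot_orth _ _ oU oV) /frame_map => <-.
by rewrite trmxK orth_frameKV.
Qed.

Lemma normal_frame U V N : orth U -> orth V ->
  normal_vectors V7 M5 (U *m P0 *m V^T) N <->
  exists a b, N = U *m planar 0 a b *m V^T.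
Proof.
move=> oU oV; split=> [|[a [b ->]]]; last first.
  by apply: normal_vectors_frame => //; apply/normal_planar; exists a, b.
move=> /(normal_vectors_frame (orth_tr oU) (orth_tr oV)).
rewrite /frame_map trmxK orth_frameK // => /normal_planar[a [b NE]].
by exists a, b; rewrite -NE orth_frameKV.
Qed.

Lemma tangent_planar v :
  tangent_space [set A | exists p a b, A = planar p a b] P0 v ->
  exists p a b, v = planar p a b.
Proof.
move=> [I [g [[oI I0 sg] [gV g0 gv]]]].
have dg : is_velocity g 0 v by rewrite -gv; exact: is_velocity_curve sg I0.
have nI : \forall s \near (0 : R^o), I s by exact: open_nbhs_nbhs (conj oI I0).
have v0 i j : (forall p a b, planar p a b i j = 0) -> v i j = 0.
  move=> H; have [_ <-] := dg i j.
  rewrite (near_eq_derive (g := cst (0 : R^o))) ?derive_cst //.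
  by apply: filterS nI => s /gV[p [a [b ->]]]; exact: H.
have v10 : v 1 0 = v 0 1.
  have [_ <-] := dg 0 1; have [_ <-] := dg 1 0; apply: near_eq_derive.
  by apply: filterS nI => s /gV[p [a [b ->]]]; rewrite !mxE.
exists ((v 0 0 + v 1 1) / 2), ((v 0 0 - v 1 1) / 2), (v 0 1).
rewrite {1}(mx3E v) (v0 0 2) ?(v0 1 2) ?(v0 2 0) ?(v0 2 1) ?(v0 2 2) ?v10;
  try by move=> *; rewrite !mxE.
by rewrite /planar; congr mx3; field.
Qed.

End NormalVectors.

(** * The sphere exponential on normal vectors *)

Section SphereExp.
Context {R : realType}.
Implicit Types (A B U V P N v : 'M[R]_3) (a b p t k : R).

Definition framed U V p a b := U *m planar p a b *m V^T.

Lemma framedZ U V k p a b : k *: framed U V p a b = framed U V (k * p) (k * a) (k * b).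
Proof.
rewrite /framed scalemxAl scalemxAr; congr (_ *m _ *m _).
by rewrite /planar mx3Z; congr mx3; ring.
Qed.

Lemma framedD U V p a b p' a' b' :
  framed U V p a b + framed U V p' a' b' = framed U V (p + p') (a + a') (b + b').
Proof.
rewrite /framed -mulmxDl -mulmxDr; congr (_ *m _ *m _).
by rewrite /planar mx3D; congr mx3; ring.
Qed.

Lemma edot_framed U V p a b p' a' b' : orth U -> orth V ->
  edot (framed U V p a b) (framed U V p' a' b') = 2 * (p * p' + a * a' + b * b').
Proof. by move=> oU oV; rewrite edot_orth // edot_planar. Qed.

Lemma cos_pi4 : cos (pi / 4) ^+ 2 = 1 / 2 :> R.
Proof.
have := cos_mulr2n (pi / 4 : R).
have -> : pi / 4 *+ 2 = pi / 2 :> R by rewrite mulr2n; field.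
rewrite cos_pihalf mulr2n; lra.
Qed.

(** The angle pi/4 is where the cosine and the sine are equal, that is, where
    the smaller singular value vanishes. *)
Lemma lt_pi4E t : 0 <= t <= pi -> (t < pi / 4) = (0 < cos t) && (1 / 2 < cos t ^+ 2).
Proof.
move=> /[dup] tpi /andP[t0 _]; have pi0 := pi_gt0 R.
have c4 : 0 < cos (pi / 4 : R) by apply: cos_gt0_pihalf; lra.
rewrite -ltr_cos ?in_itv//=; last by lra.
rewrite -cos_pi4; apply/idP/andP => [H|[c0]].
  by split; [exact: lt_trans H|rewrite ltrXn2r // ltW].
by rewrite ltr_pXn2r // nnegrE ltW.
Qed.

Lemma cos_lt_pi4 t : 0 <= t < pi / 4 -> 0 < cos t /\ sin t ^+ 2 < cos t ^+ 2.
Proof.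
move=> /andP[t0 t4]; have pi0 := pi_gt0 R.
have := t4; rewrite lt_pi4E ?t0 /=; last by lra.
by move=> /andP[? ?]; split=> //; have := cos2Dsin2 t; lra.
Qed.

Lemma sin_neq0_pi4 t : 0 <= t < pi / 4 -> t != 0 -> sin t != 0.
Proof.
move=> /andP[t0 t4] tn0; have pi0 := pi_gt0 R.
have tgt0 : 0 < t by rewrite lt0r tn0.
by rewrite gt_eqF // sin_gt0_pihalf // tgt0 /=; lra.
Qed.

Lemma angular_length_sqr N : angular_length N ^+ 2 = edot N N / 3.
Proof. by rewrite expr_div_n enorm_sqr sqr_sqrtr. Qed.

Lemma angular_length_ge0 N : 0 <= angular_length N.
Proof. by rewrite divr_ge0 ?enorm_ge0 ?sqrtr_ge0. Qed.

(** The passage from a normal vector (a, b) of angular length t to its image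
    (a', b'), and back by any number r that stands for t / sin t. At t = 0 both
    vectors are 0, and the default value of 0 / 0 is harmless. *)
Lemma sinc_rescale t a b a' b' k : t ^+ 2 = 2 * (a ^+ 2 + b ^+ 2) / 3 ->
  k = sin t / t -> (0 <= t < pi / 4) -> a' = k * a -> b' = k * b ->
  2 * (a' ^+ 2 + b' ^+ 2) = 3 * sin t ^+ 2 /\
  forall r, r * sin t = t -> a = r * a' /\ b = r * b'.
Proof.
move=> t2 -> /andP[t0 t4] -> ->.
have ab : a ^+ 2 + b ^+ 2 = 3 / 2 * t ^+ 2 by lra.
have [t_eq0|tn0] := eqVneq t 0.
  have [-> ->] : a = 0 /\ b = 0.
    by apply: sqrD_eq0; rewrite ab t_eq0 expr0n mulr0.
  rewrite t_eq0 sin0 !mulr0 expr0n /= addr0 mulr0.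
  by split=> [|r _]; rewrite !mulr0.
have s0 : sin t != 0 by apply: sin_neq0_pi4; rewrite ?t0.
split.
  have -> : 2 * ((sin t / t * a) ^+ 2 + (sin t / t * b) ^+ 2) =
      2 * (sin t / t) ^+ 2 * (a ^+ 2 + b ^+ 2) by ring.
  by rewrite ab; field.
move=> r rs; have {rs} -> : r = t / sin t by apply: (canRL (mulfK s0)).
by split; field; rewrite s0 tn0.
Qed.

Lemma sphere_exp_polar U V a b : orth U -> orth V ->
  angular_length (framed U V 0 a b) < pi / 4 ->
  exists t a' b', [/\ 0 <= t < pi / 4, 2 * (a' ^+ 2 + b' ^+ 2) = 3 * sin t ^+ 2,
    sphere_exp (framed U V best_scale 0 0, framed U V 0 a b) =
      framed U V (cos t * best_scale) a' b' &
    forall r, r * sin t = t -> a = r * a' /\ b = r * b'].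
Proof.
move=> oU oV t4; rewrite /sphere_exp /=.
have t2 := angular_length_sqr (framed U V 0 a b).
have t0 := angular_length_ge0 (framed U V 0 a b).
move: (angular_length _) t4 t2 t0 => t t4 t2 t0.
have ht : 0 <= t < pi / 4 by rewrite t0.
rewrite edot_framed // mulr0 add0r -!expr2 in t2.
have [Hs Hr] := sinc_rescale t2 erefl ht erefl erefl.
exists t, (sin t / t * a), (sin t / t * b); split=> //.
by rewrite !framedZ framedD; congr framed; ring.
Qed.

(** The normal vector is (a, b) stretched by t / sin t. *)
Lemma sphere_exp_of_polar U V t a b : orth U -> orth V ->
  0 <= t < pi / 4 -> 2 * (a ^+ 2 + b ^+ 2) = 3 * sin t ^+ 2 ->
  exists2 N, disk_bundle V7 M5 (pi / 4) (framed U V best_scale 0 0, N) &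
    sphere_exp (framed U V best_scale 0 0, N) = framed U V (cos t * best_scale) a b.
Proof.
move=> oU oV ht ab; have /andP[t0 t4] := ht.
pose r := t / sin t.
have [alt kr] : angular_length (framed U V 0 (r * a) (r * b)) = t /\
    (sin t / t * (r * a) = a /\ sin t / t * (r * b) = b).
  have t2 := angular_length_sqr (framed U V 0 (r * a) (r * b)).
  rewrite edot_framed // mulr0 add0r -!expr2 in t2.
  have {}t2 : angular_length (framed U V 0 (r * a) (r * b)) ^+ 2 = (r * sin t) ^+ 2.
    have -> : (r * sin t) ^+ 2 = r ^+ 2 * (3 * sin t ^+ 2) / 3 by field.
    by rewrite t2 -ab; field.
  have [t_eq0|tn0] := eqVneq t 0.
    have [-> ->] : a = 0 /\ b = 0.
      by apply: sqrD_eq0; rewrite t_eq0 sin0 expr0n /= in ab; lra.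
    rewrite !mulr0 t_eq0; split=> //.
    apply/eqP; rewrite -sqrf_eq0 angular_length_sqr edot_framed //.
    by rewrite !mulr0 !addr0 mulr0 mul0r.
  have s0 := sin_neq0_pi4 ht tn0.
  split; last by rewrite /r; split; field; rewrite s0 tn0.
  apply/eqP; rewrite -(@eqrXn2 _ 2) ?angular_length_ge0 // t2 /r divfK //.
exists (framed U V 0 (r * a) (r * b)).
  split=> /=; first by apply/M5_frame; exists U, V.
    by apply/(normal_frame _ oU oV); exists (r * a), (r * b).
  by rewrite alt.
rewrite /sphere_exp /= alt !framedZ framedD; have [-> ->] := kr.
by congr framed; ring.
Qed.

Lemma normal_framed U V N : orth U -> orth V ->
  normal_vectors V7 M5 (framed U V best_scale 0 0) N <->
  exists a b, N = framed U V 0 a b.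
Proof. exact: normal_frame. Qed.

(** The cross section in polar coordinates of the plane of normal vectors. *)
Lemma cross_section_framed U V A : orth U -> orth V ->
  cross_section V7 M5 (pi / 4) (framed U V best_scale 0 0) A <->
  exists t a b, [/\ 0 <= t < pi / 4, 2 * (a ^+ 2 + b ^+ 2) = 3 * sin t ^+ 2 &
    A = framed U V (cos t * best_scale) a b].
Proof.
move=> oU oV; split=> [[t [T [ht /(normal_framed _ oU oV)[a [b ->]] T3 ->]]]|].
  exists t, (sin t * a), (sin t * b); split=> //.
    move: T3 => /enormP; rewrite edot_framed // => /(_ (ler0n _ 3)) T3.
    by rewrite -T3; ring.
  by rewrite !framedZ framedD; congr framed; ring.
move=> [t [a [b [ht ab ->]]]].
have [a' [b' [-> -> ab']]] : exists a' b', [/\ a = sin t * a', b = sin t * b' &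
    2 * (a' ^+ 2 + b' ^+ 2) = 3].
  have [s0|s0] := eqVneq (sin t) 0.
    have [-> ->] : a = 0 /\ b = 0.
      by apply: sqrD_eq0; rewrite s0 expr0n /= in ab; lra.
    by exists best_scale, 0; rewrite s0 !mul0r best_scale_sqr; split=> //; lra.
  exists (a / sin t), (b / sin t); split; try by field.
  rewrite !expr_div_n -mulrDl mulrA ab; field.
  exact: s0.
exists t, (framed U V 0 a' b'); split=> //.
- by apply/normal_framed => //; exists a', b'.
- by apply/enormP => //; rewrite edot_framed // -ab'; ring.
- by rewrite !framedZ framedD; congr framed; ring.
Qed.

Lemma sphere_exp_cross_section P : M5 P ->
  sphere_exp @` (disk_bundle V7 M5 (pi / 4) `&` [set PN | PN.1 = P]) =
  cross_section V7 M5 (pi / 4) P.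
Proof.
move=> /M5_frame[U [V [oU oV ->]]]; apply/seteqP; split=> A.
  move=> [[Q N] [[/= MQ nQ aN] QE] <-].
  move: QE nQ => -> /(normal_framed _ oU oV)[a [b NE]].
  rewrite NE in aN *; apply/cross_section_framed => //.
  have [t [a' [b' [ht ab -> _]]]] := sphere_exp_polar oU oV aN.
  by exists t, a', b'.
move=> /(cross_section_framed _ oU oV)[t [a [b [ht ab ->]]]].
have [N dN <-] := sphere_exp_of_polar oU oV ht ab.
by exists (framed U V best_scale 0 0, N).
Qed.

Lemma rank2_framed U V p a b : orth U -> orth V ->
  2 * (p ^+ 2 + a ^+ 2 + b ^+ 2) = 3 -> a ^+ 2 + b ^+ 2 < p ^+ 2 ->
  (V7 `\` M4) (framed U V p a b).
Proof.
move=> oU oV E pab; apply/rank2P; split.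
  by apply: V7_orth => //; exact: V7_planar.
by rewrite minors_sqr_orth // minors_sqr_planar mulr_gt0 // exprn_gt0 //; lra.
Qed.

Lemma polar_length t a b : 2 * (a ^+ 2 + b ^+ 2) = 3 * sin t ^+ 2 ->
  2 * ((cos t * best_scale) ^+ 2 + a ^+ 2 + b ^+ 2) = 3.
Proof.
by move=> ab; rewrite exprMn best_scale_sqr; have := cos2Dsin2 t; lra.
Qed.

Lemma polar_dominant t a b : 0 <= t < pi / 4 ->
  2 * (a ^+ 2 + b ^+ 2) = 3 * sin t ^+ 2 -> 0 < cos t * best_scale /\
  a ^+ 2 + b ^+ 2 < (cos t * best_scale) ^+ 2.
Proof.
move=> /cos_lt_pi4[c0 sc] ab; split; first by rewrite mulr_gt0 ?best_scale_gt0.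
by rewrite exprMn best_scale_sqr; lra.
Qed.

(** In the form of [planar_form], the angle t is the arc cosine of
    p / best_scale. *)
Lemma sphere_exp_surj A : (V7 `\` M4) A ->
  exists2 PN, disk_bundle V7 M5 (pi / 4) PN & sphere_exp PN = A.
Proof.
move=> [[/S8P A3 dA] rA].
have {}rA : \rank A != 1%N.
  by apply/eqP => r1; apply: rA; split=> //; split=> //; exact/S8P.
have [U [V [oU oV [p [a [b [AE p0 pab]]]]]]] := planar_form A3 dA rA.
rewrite AE -/(framed U V p a b) in A3 *; rewrite edot_framed // -!expr2 in A3.
have c0 := @best_scale_gt0 R; have cN0 : best_scale != 0 :> R by rewrite gt_eqF.
have pc2 : (p / best_scale) ^+ 2 = p ^+ 2 * (2 / 3).
  by rewrite expr_div_n best_scale_sqr; field.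
have pc0 : 0 < p / best_scale by rewrite divr_gt0.
have pc : -1 <= p / best_scale <= 1.
  apply/andP; split; first by lra.
  rewrite -(@ler_pXn2r _ 2) ?nnegrE ?(ltW pc0)// pc2 expr1n.
  by have := sqr_ge0 a; have := sqr_ge0 b; lra.
pose t := acos (p / best_scale).
have ct : cos t = p / best_scale by rewrite acosK // in_itv.
have ht : 0 <= t < pi / 4.
  rewrite acos_ge0 //= lt_pi4E ?acos_ge0 ?acos_lepi// -/t ct pc0 pc2; lra.
have ab : 2 * (a ^+ 2 + b ^+ 2) = 3 * sin t ^+ 2.
  by have := cos2Dsin2 t; rewrite ct pc2; lra.
have [N dN E] := sphere_exp_of_polar oU oV ht ab.
by exists (framed U V best_scale 0 0, N) => //; rewrite E ct divfK.
Qed.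

End SphereExp.

(** * The inverse of the exponential *)

Section Retraction.
Context {R : realType}.
Implicit Types (A B U V P N : 'M[R]_3) (a b p t k : R).

Lemma smooth_minors_sqr (U : set 'M[R]_3) : open U ->
  smooth_on U (@minors_sqr R : 'M[R]_3 -> R^o).
Proof.
move=> oU; have sid := @smooth_on_id _ _ U.
have sA := smooth_edot oU sid sid.
have sS := smooth_mxM oU (smooth_mxT oU sid) sid.
rewrite (_ : (minors_sqr : _ -> _) = fun A => edot A A * edot A A +
  (-1) * edot (A^T *m A) (A^T *m A)); last first.
  by apply/funext => A; rewrite /minors_sqr; ring.
apply: smooth_onD => //; first exact: smooth_onM.
by apply: smooth_cstM => //; exact: (smooth_edot oU sS sS).
Qed.

Lemma minors_sqr_continuous : continuous (@minors_sqr R : 'M[R]_3 -> R^o).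
Proof. by apply: smooth_on_continuous; apply: smooth_minors_sqr; exact: openT. Qed.

(** On U (planar p a b) V^T with a^2 + b^2 < p^2 these are p^2 - a^2 - b^2 and
    U (planar p (-a) (-b)) V^T, the transpose of the adjugate of the planar
    block; the formula comes from the Cayley-Hamilton identity. *)
Definition planar_det A : R := Num.sqrt (minors_sqr A / 2).
Definition planar_cofactor A : 'M[R]_3 :=
  (planar_det A)^-1 *: (edot A A *: A + (-1) *: (A *m A^T *m A)).
(** The mean of A and its planar cofactor is cos(t) times the foot point, and
    3 + 2 * planar_det A = 6 cos(t)^2. *)
Definition footpoint A : 'M[R]_3 :=
  (best_scale * (Num.sqrt (3 + 2 * planar_det A))^-1) *: (A + planar_cofactor A).
(** The square of sin t, since planar_det A = (3/2) cos(2 t). *)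
Definition sin_sqr_angle A : R := 1 / 2 + (- (1 / 3)) * planar_det A.
(** The half difference of A and its planar cofactor is sin(t) / t times the
    normal vector; r is the ratio t / sin t as a function of sin(t)^2. *)
Definition normal_part (r : R -> R) A : 'M[R]_3 :=
  (r (sin_sqr_angle A) * (1 / 2)) *: (A + (-1) *: planar_cofactor A).

Lemma planar_det_framed U V p a b : orth U -> orth V ->
  a ^+ 2 + b ^+ 2 < p ^+ 2 ->
  planar_det (framed U V p a b) = p ^+ 2 - a ^+ 2 - b ^+ 2.
Proof.
move=> oU oV pab; have d0 : 0 <= p ^+ 2 - a ^+ 2 - b ^+ 2 by lra.
rewrite /planar_det minors_sqr_orth // minors_sqr_planar mulrAC divff // mul1r.
by rewrite sqrtr_sqr ger0_norm.
Qed.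

Lemma planar_cofactor_framed U V p a b : orth U -> orth V ->
  2 * (p ^+ 2 + a ^+ 2 + b ^+ 2) = 3 -> a ^+ 2 + b ^+ 2 < p ^+ 2 ->
  planar_cofactor (framed U V p a b) = framed U V p (- a) (- b).
Proof.
move=> oU oV pab3 pab; have d0 : p ^+ 2 - a ^+ 2 - b ^+ 2 != 0.
  by rewrite gt_eqF //; lra.
rewrite /planar_cofactor planar_det_framed // edot_framed //.
rewrite [X in _ + _ *: X]frame_cube //.
have -> : planar p a b *m (planar p a b)^T *m planar p a b =
    (2 * (p ^+ 2 + a ^+ 2 + b ^+ 2)) *: planar p a b +
    (- (p ^+ 2 - a ^+ 2 - b ^+ 2)) *: planar p (- a) (- b).
  by rewrite /planar mx3T !mx3M !mx3Z mx3D; congr mx3; ring.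
rewrite mulmxDr mulmxDl -!scalemxAr -!scalemxAl -!/(framed _ _ _ _ _).
rewrite !framedZ !framedD !framedZ framedD !framedZ.
by congr framed; field.
Qed.

Lemma footpoint_framed U V p a b : orth U -> orth V ->
  2 * (p ^+ 2 + a ^+ 2 + b ^+ 2) = 3 -> a ^+ 2 + b ^+ 2 < p ^+ 2 ->
  0 < p -> footpoint (framed U V p a b) = framed U V best_scale 0 0.
Proof.
move=> oU oV pab3 pab p0.
rewrite /footpoint planar_cofactor_framed // planar_det_framed //.
have -> : 3 + 2 * (p ^+ 2 - a ^+ 2 - b ^+ 2) = (2 * p) ^+ 2 by rewrite -pab3; ring.
rewrite sqrtr_sqr ger0_norm; last by rewrite mulr_ge0 // ltW.
by rewrite framedD framedZ !subrr mulr0; congr framed; field; rewrite gt_eqF.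
Qed.

Lemma sin_sqr_angle_framed U V p a b : orth U -> orth V ->
  2 * (p ^+ 2 + a ^+ 2 + b ^+ 2) = 3 -> a ^+ 2 + b ^+ 2 < p ^+ 2 ->
  3 * sin_sqr_angle (framed U V p a b) = 2 * (a ^+ 2 + b ^+ 2).
Proof. by move=> oU oV pab3 pab; rewrite /sin_sqr_angle planar_det_framed //; lra. Qed.

Lemma normal_part_framed U V p a b r s : orth U -> orth V ->
  2 * (p ^+ 2 + a ^+ 2 + b ^+ 2) = 3 -> a ^+ 2 + b ^+ 2 < p ^+ 2 ->
  sin_sqr_angle (framed U V p a b) = s ->
  normal_part r (framed U V p a b) = framed U V 0 (r s * a) (r s * b).
Proof.
move=> oU oV pab3 pab E; rewrite /normal_part E planar_cofactor_framed //.
by rewrite framedZ framedD framedZ; congr framed; field.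
Qed.

(** A formula for the exponential that is smooth everywhere. *)
Definition sphere_exp_ext (PN : 'M[R]_3 * 'M[R]_3) : 'M[R]_3 :=
  cosq (1 / 3 * edot PN.2 PN.2) *: PN.1 + sincq (1 / 3 * edot PN.2 PN.2) *: PN.2.

Lemma sphere_expE PN : sphere_exp PN = sphere_exp_ext PN.
Proof.
rewrite /sphere_exp /sphere_exp_ext; have t2 := angular_length_sqr PN.2.
have -> : 1 / 3 * edot PN.2 PN.2 = angular_length PN.2 ^+ 2 by rewrite t2 mulrC mul1r.
rewrite cosqE; congr (_ + _).
have [t0|t0] := eqVneq (angular_length PN.2) 0.
  suff -> : PN.2 = 0 by rewrite !scaler0.
  apply: edot_eq0; rewrite t0 expr0n /= in t2; lra.
by rewrite -sincqE mulrAC divff // mul1r.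
Qed.

Lemma smooth_sphere_exp_ext : smooth_on setT sphere_exp_ext.
Proof.
have oT : open [set: 'M[R]_3 * 'M[R]_3] by exact: openT.
have sP := @smooth_on_fst _ _ _ [set: 'M[R]_3 * 'M[R]_3].
have sN := @smooth_on_snd _ _ _ [set: 'M[R]_3 * 'M[R]_3].
have sE := smooth_cstM oT (1 / 3) (smooth_edot oT sN sN).
apply: smooth_onD => //; apply: smooth_mxZ => //.
  by apply: (smooth_on_comp1 oT (@smooth_cosq R setT)).
by apply: (smooth_on_comp1 oT (@smooth_sincq R setT)).
Qed.

Lemma sin_sqr_angle_continuous : continuous (sin_sqr_angle : 'M[R]_3 -> R^o).
Proof.
move=> A; have cq : (fun B => minors_sqr B / 2 : R^o) @ A --> (minors_sqr A / 2 : R^o).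
  exact: (cvgMr_tmp (@minors_sqr_continuous A)).
have cd : (planar_det : _ -> R^o) @ A --> (planar_det A : R^o).
  exact: (continuous_comp cq (@sqrt_continuous R _)).
exact: (cvgD (cvg_cst (1 / 2 : R^o)) (cvgMl_tmp cd)).
Qed.

Lemma smooth_retraction (I : set R^o) (r : R^o -> R^o) (U : set 'M[R]_3) :
  smooth_on I r -> open U ->
  (forall A, U A -> 0 < minors_sqr A /\ I (sin_sqr_angle A)) ->
  smooth_on U (fun A => (footpoint A, normal_part r A) : 'M[R]_3 * 'M[R]_3).
Proof.
move=> sr oU UI; have sid := @smooth_on_id _ _ U.
have q0 A : U A -> 0 < 1 / 2 * minors_sqr A by move=> /UI[? _]; rewrite mulr_gt0.
have sd : smooth_on U (planar_det : 'M[R]_3 -> R^o).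
  rewrite (_ : planar_det = fun A => Num.sqrt (1 / 2 * minors_sqr A)); last first.
    by apply/funext => A; rewrite /planar_det mulrC mul1r.
  by apply: smooth_sqrt => //; apply: smooth_cstM => //; exact: smooth_minors_sqr.
have d0 A : U A -> 0 < planar_det A.
  by move=> UA; rewrite sqrtr_gt0; have := q0 _ UA; lra.
have sA : smooth_on U planar_cofactor.
  apply: smooth_mxZ => //.
    by apply: smooth_inv => // A /d0; exact: lt0r_neq0.
  apply: smooth_onD => //.
    by apply: smooth_mxZ => //; exact: (smooth_edot oU sid sid).
  apply: smooth_mxZ => //; first exact: smooth_on_cst.
  exact: (smooth_mxM oU (smooth_mxM oU sid (smooth_mxT oU sid)) sid).
have s32 : smooth_on U (fun A => 3 + 2 * planar_det A : R^o).
  by apply: smooth_onD => //; [exact: smooth_on_cst|exact: smooth_cstM].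
have p32 A : U A -> 0 < 3 + 2 * planar_det A by move=> /d0 ?; lra.
move=> k; apply: Ck_on_pair => //.
  apply: smooth_mxZ => //; last exact: smooth_onD.
  apply: smooth_cstM => //; apply: smooth_inv => //; last exact: smooth_sqrt.
  by move=> A /p32 ?; rewrite gt_eqF // sqrtr_gt0.
apply: smooth_mxZ => //.
  apply: smooth_onM => //; last exact: smooth_on_cst.
  apply: (smooth_on_comp1 oU sr) => [A /UI[]//|].
  by apply: smooth_onD => //; [exact: smooth_on_cst|exact: smooth_cstM].
by apply: smooth_onD => //; apply: smooth_mxZ => //; exact: smooth_on_cst.
Qed.

End Retraction.

(** * The cells on great spheres *)

Section Cells.
Context {R : realType}.
Implicit Types (A B U V P N v : 'M[R]_3) (a b p t k : R).

Lemma framed_inj U V p a b p' a' b' : orth U -> orth V ->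
  framed U V p a b = framed U V p' a' b' -> [/\ p = p', a = a' & b = b'].
Proof.
move=> oU oV /(congr1 (fun A => U^T *m A *m V)); rewrite !orth_frameK //.
move=> /matrixP E; have := E 0 0; have := E 0 1; have := E 1 1.
by rewrite !mxE /= => E11 E01 E00; split; lra.
Qed.

Lemma range_vspace n (f : {linear 'rV[R]_n -> 'M[R]_3}) : injective f ->
  exists2 L : {vspace 'M[R]_3}, \dim L = n & forall A, A \in L <-> exists x, A = f x.
Proof.
move=> finj; exists (limg (linfun f)).
  rewrite limg_dim_eq ?dimvf /dim /= ?mul1n //.
  apply/eqP; rewrite -subv0; apply/subvP => x.
  rewrite memv_cap memvf /= memv_ker lfunE /= memv0 => /eqP fx.
  by apply/eqP/finj; rewrite fx linear0.
move=> A; split=> [/memv_imgP[x _ ->]|[x ->]]; first by exists x; rewrite lfunE.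
by rewrite -[f x]lfunE memv_img ?memvf.
Qed.

Definition cell_param U V (x : 'rV[R]_3) := framed U V (x 0 0) (x 0 1) (x 0 2).

Lemma cell_param_linear U V : linear (cell_param U V).
Proof. by move=> k x y; rewrite /cell_param framedZ framedD !mxE. Qed.

HB.instance Definition _ U V := GRing.isLinear.Build R 'rV[R]_3 'M[R]_3 *:%R
  (cell_param U V) (cell_param_linear U V).

Definition normal_param U V (x : 'rV[R]_2) := framed U V 0 (x 0 0) (x 0 1).

Lemma normal_param_linear U V : linear (normal_param U V).
Proof. by move=> k x y; rewrite /normal_param framedZ framedD !mxE mulr0 addr0. Qed.

HB.instance Definition _ U V := GRing.isLinear.Build R 'rV[R]_2 'M[R]_3 *:%R
  (normal_param U V) (normal_param_linear U V).

Lemma cell_vspace U V : orth U -> orth V -> exists2 W : {vspace 'M[R]_3},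
  \dim W = 3%N & forall A, A \in W <-> exists p a b, A = framed U V p a b.
Proof.
move=> oU oV; have [|W dW WE] := @range_vspace 3 (cell_param U V).
  move=> x y /framed_inj[]// E0 E1 E2; apply/rowP => i.
  case: i => [[|[|[|//]]] i3].
  - by rewrite -[Ordinal _](_ : 0 = _) //; exact: val_inj.
  - by rewrite -[Ordinal _](_ : 1 = _) //; exact: val_inj.
  - by rewrite -[Ordinal _](_ : 2 = _) //; exact: val_inj.
exists W => // A; rewrite WE; split=> [[x ->]|[p [a [b ->]]]].
  by exists (x 0 0), (x 0 1), (x 0 2).
exists (\row_i nth 0 [:: p; a; b] i).
by rewrite /cell_param /= /cell_param !mxE.
Qed.

Lemma normal_vspace U V : orth U -> orth V -> exists2 L : {vspace 'M[R]_3},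
  \dim L = 2%N & normal_vectors V7 M5 (framed U V best_scale 0 0) = [set` L].
Proof.
move=> oU oV; have [|L dL LE] := @range_vspace 2 (normal_param U V).
  move=> x y /framed_inj[]// _ E0 E1; apply/rowP => i.
  case: i => [[|[|//]] i2].
  - by rewrite -[Ordinal _](_ : 0 = _) //; exact: val_inj.
  - by rewrite -[Ordinal _](_ : 1 = _) //; exact: val_inj.
exists L => //; apply/seteqP; split=> N.
  move=> /(normal_framed _ oU oV)[a [b ->]]; apply/LE.
  by exists (\row_i nth 0 [:: a; b] i); rewrite /normal_param /= /normal_param !mxE.
by move=> /LE[x ->]; apply/normal_framed => //; exists (x 0 0), (x 0 1).
Qed.

Lemma angle_framed U V p a b : orth U -> orth V ->
  2 * (p ^+ 2 + a ^+ 2 + b ^+ 2) = 3 ->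
  angle (framed U V best_scale 0 0) (framed U V p a b) = acos (p / best_scale).
Proof.
move=> oU oV E; rewrite /angle !enormE !edot_framed // -!expr2 E best_scale_sqr.
have -> : 2 * (3 / 2 + 0 ^+ 2 + 0 ^+ 2) = 3 :> R by field.
rewrite -expr2 sqr_sqrtr //; congr acos.
have c0 : best_scale != 0 :> R by rewrite gt_eqF // best_scale_gt0.
have -> : 3 = 2 * best_scale ^+ 2 :> R by rewrite best_scale_sqr; field.
by field.
Qed.

(** On the great sphere of the matrices U (planar p a b) V^T, the angle with the
    centre is the arc cosine of p / best_scale. *)
Lemma cross_section_round U V (W : {vspace 'M[R]_3}) : orth U -> orth V ->
  (forall A, A \in W <-> exists p a b, A = framed U V p a b) ->
  cross_section V7 M5 (pi / 4) (framed U V best_scale 0 0) =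
  round_cell (S8 `&` [set` W]) (pi / 4) (framed U V best_scale 0 0).
Proof.
move=> oU oV WE; have c0 := @best_scale_gt0 R.
have cN0 : best_scale != 0 :> R by rewrite gt_eqF.
have pi0 := pi_gt0 R.
apply/seteqP; split=> A.
  move=> /(cross_section_framed _ oU oV)[t [a [b [/andP[t0 t4] ab ->]]]].
  have E := polar_length ab; split.
    split; last by apply/WE; exists (cos t * best_scale), a, b.
    by apply/S8P; rewrite edot_framed // -!expr2.
  by rewrite angle_framed // mulfK // cosK // in_itv /= t0 /=; lra.
move=> [[/S8P A3 /WE[p [a [b AE]]]]]; move: A3; rewrite AE edot_framed // -!expr2 => E.
rewrite angle_framed // => t4; apply/cross_section_framed => //.
have pc2 : (p / best_scale) ^+ 2 = p ^+ 2 * (2 / 3).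
  by rewrite expr_div_n best_scale_sqr; field.
have pc : -1 <= p / best_scale <= 1.
  rewrite -ler_norml -(@ler_pXn2r _ 2) ?nnegrE// real_normK ?num_real // pc2 expr1n.
  by have := sqr_ge0 a; have := sqr_ge0 b; lra.
have ct : cos (acos (p / best_scale)) = p / best_scale by rewrite acosK // in_itv.
exists (acos (p / best_scale)), a, b; rewrite acos_ge0 //= t4; split=> //.
  by have := cos2Dsin2 (acos (p / best_scale)); rewrite ct pc2; lra.
by rewrite ct divfK.
Qed.

(** Tangent vectors of the great sphere have a symmetric planar block, those of
    M^5 a skew-symmetric one. *)
Lemma cell_orthogonal U V (W : {vspace 'M[R]_3}) : orth U -> orth V ->
  (forall A, A \in W <-> exists p a b, A = framed U V p a b) ->
  meet_orthogonally_at (S8 `&` [set` W]) M5 (framed U V best_scale 0 0).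
Proof.
move=> oU oV WE; split.
- split; last by apply/WE; exists best_scale, 0, 0.
  by apply/S8P; rewrite edot_framed // -!expr2 best_scale_sqr; field.
- by apply/M5_frame; exists U, V.
move=> u v tu tv.
have frP p a b : frame_map U^T V^T (framed U V p a b) = planar p a b.
  exact: frame_mapK.
have : tangent_space [set A | exists p a b, A = planar p a b] (planar best_scale 0 0)
    (frame_map U^T V^T u).
  rewrite -frP; apply: (tangent_frame _ tu) => A [_ /WE[p [a [b ->]]]] /=.
  by exists p, a, b.
move=> /tangent_planar[p [a [b uE]]].
have : tangent_space M5 (planar best_scale 0 0) (frame_map U^T V^T v).
  rewrite -frP; apply: (tangent_frame _ tv) => A.
  by apply: M5_frame_map; exact: orth_tr.
move=> /M5_tangent[v00 v11 v01].
rewrite -(edot_orth u v (orth_tr oU) (orth_tr oV)).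
rewrite -/(frame_map _ _ u) -/(frame_map _ _ v) uE.
rewrite (mx3E (frame_map _ _ v)) edot_mx3 v00 v11.
have -> : frame_map U^T V^T v 1 0 = - frame_map U^T V^T v 0 1 by lra.
ring.
Qed.

End Cells.

(** * The tubular neighborhood *)

Section Tubular.
Context {R : realType}.
Implicit Types (A B U V P N v : 'M[R]_3) (a b p t k : R).

(** The planar form of the exponential determines all the data: p gives the angle,
    and its planar cofactor gives the foot point and the normal vector. *)
Lemma retraction_bundle (I : set R^o) (r : R^o -> R^o) :
  (forall t, 0 <= t < pi / 4 -> I (sin t ^+ 2) /\ r (sin t ^+ 2) * sin t = t) ->
  forall PN : 'M[R]_3 * 'M[R]_3, disk_bundle V7 M5 (pi / 4) PN ->
  [/\ (V7 `\` M4) (sphere_exp PN), I (sin_sqr_angle (sphere_exp PN)) &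
      (footpoint (sphere_exp PN), normal_part r (sphere_exp PN)) = PN].
Proof.
move=> Ir [P N] [/= /M5_frame[U [V [oU oV ->]]] + N4].
move=> /(normal_framed _ oU oV)[a [b NE]]; rewrite NE in N4 *.
have [t [a' [b' [ht ab -> ab']]]] := sphere_exp_polar oU oV N4.
have [It rt] := Ir t ht; have [-> ->] := ab' _ rt.
have E := polar_length ab; have [p0 pab] := polar_dominant ht ab.
have s2 : sin_sqr_angle (framed U V (cos t * best_scale) a' b') = sin t ^+ 2.
  by have := sin_sqr_angle_framed oU oV E pab; rewrite ab; lra.
split; first exact: rank2_framed.
  by rewrite s2.
by rewrite footpoint_framed // (normal_part_framed r oU oV E pab s2).
Qed.

Lemma open_minors_sqr_gt0 : open [set A : 'M[R]_3 | 0 < minors_sqr A].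
Proof.
apply: (@open_comp _ _ (@minors_sqr R : 'M[R]_3 -> R^o) [set x | 0 < x]) => [B _|].
  exact: minors_sqr_continuous.
exact: open_gt.
Qed.

Lemma sphere_exp_diffeo :
  diffeomorphism (disk_bundle V7 M5 (pi / 4)) (@V7 R `\` @M4 R) sphere_exp.
Proof.
have [I [r [oI sr Ir]]] := @smooth_angle_ratio R.
have GE := retraction_bundle Ir.
split.
- split.
  + by move=> PN /GE[].
  + move=> PN QN /set_mem/GE[_ _ PNE] /set_mem/GE[_ _ QNE] E.
    by rewrite E in PNE; rewrite -PNE -[RHS]QNE.
  + by move=> A /sphere_exp_surj[PN bPN <-]; exists PN.
- move=> PN _; exists setT, sphere_exp_ext; split=> //; first exact: openT.
    exact: smooth_sphere_exp_ext.
  by move=> QN _ _; exact: sphere_expE.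
exists (fun A => (footpoint A, normal_part r A)).
  by move=> PN /GE[].
move=> A NA; pose O := [set A : 'M[R]_3 | 0 < minors_sqr A /\ I (sin_sqr_angle A)].
exists O, (fun A => (footpoint A, normal_part r A)).
have oO : open O.
  apply: (@openI _ [set A | 0 < minors_sqr A] [set A | I (sin_sqr_angle A)]).
    exact: open_minors_sqr_gt0.
  apply: (@open_comp _ _ (sin_sqr_angle : 'M[R]_3 -> R^o) I) => // B _.
  exact: sin_sqr_angle_continuous.
split=> //.
  have /rank2P[_ qA] := NA; have [PN bPN AE] := sphere_exp_surj NA.
  by split=> //; rewrite -AE; have [] := GE _ bPN.
by apply: (smooth_retraction sr oO) => B.
Qed.

Lemma M5_rank2 : @M5 R `<=` V7 `\` M4.
Proof.
move=> P /M5_frame[U [V [oU oV ->]]]; apply: rank2_framed => //; rewrite best_scale_sqr.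
  by field.
by rewrite !expr0n /= addr0; lra.
Qed.

Lemma rank2_tubular :
  tubular_neighborhood (@V7 R) (@M5 R) (pi / 4) (@V7 R `\` @M4 R).
Proof.
have [[bij_fun bij_inj bij_surj] _ _] := sphere_exp_diffeo.
split.
- exact: M5_rank2.
- exists [set A : 'M[R]_3 | 0 < minors_sqr A].
    exact: open_minors_sqr_gt0.
  by apply/seteqP; split=> A /rank2P.
- move=> P Q MP MQ [A []]; rewrite -!sphere_exp_cross_section //.
  move=> [PN [bPN <-] <-] [QN [bQN <-] QPE].
  by rewrite (bij_inj QN PN) ?inE.
- apply/seteqP; split=> A.
    move=> [P MP]; rewrite -sphere_exp_cross_section // => -[PN [bPN _] <-].
    exact: bij_fun.
  move=> /sphere_exp_surj[[P N] bPN <-]; exists P; first by have [] := bPN.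
  by rewrite -sphere_exp_cross_section; [exists (P, N)|have [] := bPN].
- split; first exact: sphere_exp_diffeo.
  exact: sphere_exp_cross_section.
Qed.

End Tubular.

Theorem mainTheorem5 (R : realType) :
  tubular_neighborhood (@V7 R) (@M5 R) (pi / 4) (@V7 R `\` @M4 R) /\
  (forall P : 'M[R]_3, M5 P ->
     (exists2 L : {vspace 'M[R]_3},
        \dim L = 2%N & normal_vectors (@V7 R) (@M5 R) P = [set` L]) /\
     (exists Sigma : set 'M[R]_3,
        [/\ great_2sphere Sigma,
            meet_orthogonally_at Sigma (@M5 R) P &
            cross_section (@V7 R) (@M5 R) (pi / 4) P =
            round_cell Sigma (pi / 4) P])).
Proof.
split=> [|P /M5_frame[U [V [oU oV ->]]]]; first exact: rank2_tubular.
split; first exact: normal_vspace.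
have [W dW WE] := cell_vspace oU oV.
exists (S8 `&` [set` W]); split.
- by exists W.
- exact: cell_orthogonal.
- exact: cross_section_round.
Qed.
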